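(* For every integer $k\ge0$, the generating function $\mathrm{MG}^{>0}_k(z)$ of positive multigraphs of excess $k$ has the following two expressions: $$\mathrm{MG}^{>0}_k(z)=\frac{\mathrm{MK}_k(T(z))}{(1-T(z))^{3k}},\qquad \mathrm{MG}^{>0}_k(z)=(2k-1)!!\,[x^{2k}]\sqrt{1-T(z)}\,B(z,x)^{k+1/2},$$ where $\mathrm{MK}_k(T)$ is a polynomial of degree $2k$, and $$\mathrm{MK}_k(T)=(2k-1)!!\,(1-T)^{2k}[x^{2k}]\left(1-\frac{T}{1-T}\frac{e^x-1-x-x^2/2}{x^2/2}\right)^{-k-1/2},$$ $$B(z,x)=\left(1-T(z)\frac{e^x-1-x}{x^2/2}\right)^{-1}.$$
   Context: A multigraph with $n$ vertices and $m$ edges has vertex set $\{1,\dots,n\}$ and edges labelled $1,\dots,m$; each edge is a triple $(v,w,e)$ with $v,w$ vertices (possibly equal; the edge is oriented from $v$ to $w$) and $e$ its label. Loops and multiple edges are allowed. Write $n(G)$, $m(G)$ for the numbers of vertices and edges; the excess is $m(G)-n(G)$. A multigraph is positive if every connected component has positive excess (the empty multigraph is positive). The generating function of the multigraphs of excess $k$ in a family $\mathcal{F}$ is $F_k(z)=\sum_{G\in\mathcal{F},\,m(G)-n(G)=k}\frac{1}{2^{m(G)}m(G)!}\frac{z^{n(G)}}{n(G)!}$. $T(z)=\sum_{n\ge1}n^{n-1}\frac{z^n}{n!}$ is the generating function of rooted labelled trees ($T(z)=ze^{T(z)}$). $(2k-1)!!=\frac{(2k)!}{2^kk!}$, and $[x^j]$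 denotes coefficient extraction in formal power series. *)

(* Defs.v *)
From HB Require Import structures.
From mathcomp Require Import all_boot all_order all_algebra.
From mathcomp Require Import boolp.

Set Implicit Arguments.
Unset Strict Implicit.
Unset Printing Implicit Defensive.

Import Order.TTheory GRing.Theory Num.Theory.
Local Open Scope ring_scope.

(** * Formal power series in one variable *)

(* [fps R] is R[[t]], as a record rather than a bare [nat -> R] so that it does
   not inherit the pointwise structures of function spaces. *)
Record fps (R : Type) := Fps { fcoef : nat -> R }.

HB.instance Definition _ (R : Type) := gen_eqMixin (fps R).
HB.instance Definition _ (R : Type) := gen_choiceMixin (fps R).

Lemma fpsP (R : Type) (f g : fps R) : (forall n, fcoef f n = fcoef g n) -> f = g.
Proof. by case: f g => [f] [g] /= fg; congr Fps; apply/funext. Qed.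

Definition fpsC (R : nmodType) (c : R) : fps R :=
  Fps (fun n => if n == 0%N then c else 0).

Definition fps_map (R S : Type) (h : R -> S) (f : fps R) : fps S :=
  Fps (fun n => h (fcoef f n)).

Section FpsRing.

Section Additive.
Variable R : zmodType.
Implicit Types f g h : fps R.

Definition fps_opp f : fps R := Fps (fun n => - fcoef f n).
Definition fps_add f g : fps R := Fps (fun n => fcoef f n + fcoef g n).

Lemma fps_addA : associative fps_add.
Proof. by move=> f g h; apply: fpsP => n /=; rewrite addrA. Qed.
Lemma fps_addC : commutative fps_add.
Proof. by move=> f g; apply: fpsP => n /=; rewrite addrC. Qed.
Lemma fps_add0 : left_id (fpsC (0 : R)) fps_add.
Proof. by move=> f; apply: fpsP => n /=; rewrite if_same add0r. Qed.
Lemma fps_addN : left_inverse (fpsC (0 : R)) fps_opp fps_add.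
Proof. by move=> f; apply: fpsP => n /=; rewrite if_same addNr. Qed.

HB.instance Definition _ :=
  GRing.isZmodule.Build (fps R) fps_addA fps_addC fps_add0 fps_addN.

Lemma fcoefD f g n : fcoef (f + g) n = fcoef f n + fcoef g n.
Proof. by []. Qed.
Lemma fcoefN f n : fcoef (- f) n = - fcoef f n.
Proof. by []. Qed.
Lemma fcoef0 n : fcoef (0 : fps R) n = 0.
Proof. exact: if_same. Qed.
Lemma fcoef_sum (I : Type) (r : seq I) (P : pred I) (F : I -> fps R) n :
  fcoef (\sum_(i <- r | P i) F i) n = \sum_(i <- r | P i) fcoef (F i) n.
Proof. exact: (big_morph (fun f => fcoef f n) (fun f g => fcoefD f g n) (fcoef0 n)). Qed.

End Additive.

Section Multiplicative.
Variable R : comNzRingType.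
Implicit Types f g h : fps R.

Definition fps_mul f g : fps R :=
  Fps (fun n => \sum_(i < n.+1) fcoef f i * fcoef g (n - i)).

Definition fps_trunc n f : {poly R} := \poly_(i < n) fcoef f i.

Lemma fcoef_mul_trunc f g n N : (n < N)%N ->
  fcoef (fps_mul f g) n = (fps_trunc N f * fps_trunc N g)`_n.
Proof.
move=> nN; rewrite coefM /=; apply: eq_bigr => i _; rewrite !coef_poly.
by rewrite (leq_ltn_trans _ nN) ?(leq_ltn_trans _ nN) ?leq_subr // -ltnS.
Qed.

Lemma fps_mulA : associative fps_mul.
Proof.
move=> f g h; apply: fpsP => n.
rewrite !(@fcoef_mul_trunc _ _ n n.+1) //.
transitivity ((fps_trunc n.+1 f * fps_trunc n.+1 g * fps_trunc n.+1 h)`_n).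
  rewrite -mulrA !coefM; apply: eq_bigr => i _; congr (_ * _).
  by rewrite coef_poly ltnS leq_subr (@fcoef_mul_trunc _ _ _ n.+1) ?ltnS ?leq_subr.
rewrite !coefM; apply: eq_bigr => i _; congr (_ * _).
by rewrite [RHS]coef_poly ltn_ord (@fcoef_mul_trunc _ _ _ n.+1).
Qed.

Lemma fps_mulC : commutative fps_mul.
Proof.
by move=> f g; apply: fpsP => n; rewrite !(@fcoef_mul_trunc _ _ n n.+1) // mulrC.
Qed.

Lemma fps_mul1 : left_id (fpsC (1 : R)) fps_mul.
Proof.
move=> f; apply: fpsP => n /=.
rewrite big_ord_recl /= mul1r subn0 big1 ?addr0 // => i _.
by rewrite mul0r.
Qed.

Lemma fps_mulDl : left_distributive fps_mul (@fps_add R).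
Proof.
move=> f g h; apply: fpsP => n /=; rewrite -big_split /=.
by apply: eq_bigr => i _; rewrite mulrDl.
Qed.

Lemma fps_1neq0 : fpsC (1 : R) != 0.
Proof.
by apply/eqP => /(congr1 (fun f => fcoef f 0))/eqP; rewrite /= oner_eq0.
Qed.

HB.instance Definition _ := GRing.Zmodule_isComNzRing.Build (fps R)
  fps_mulA fps_mulC fps_mul1 fps_mulDl fps_1neq0.

Lemma fcoefM f g n :
  fcoef (f * g) n = \sum_(i < n.+1) fcoef f i * fcoef g (n - i).
Proof. by []. Qed.
Lemma fcoef1 n : fcoef (1 : fps R) n = (n == 0%N)%:R.
Proof. by rewrite /=; case: eqP. Qed.

Lemma fpsC_zmod_morphism : zmod_morphism (@fpsC R).
Proof. by move=> a b; apply: fpsP => -[|n] //=; rewrite subr0. Qed.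
Lemma fpsC_monoid_morphism : monoid_morphism (@fpsC R).
Proof.
split=> // a b; apply: fpsP => n; rewrite fcoefM big_ord_recl /= subn0.
rewrite big1 ?addr0 => [|i _]; last by rewrite mul0r.
by case: eqP => //; rewrite mulr0.
Qed.

HB.instance Definition _ :=
  GRing.isZmodMorphism.Build R (fps R) (@fpsC R) fpsC_zmod_morphism.
HB.instance Definition _ :=
  GRing.isMonoidMorphism.Build R (fps R) (@fpsC R) fpsC_monoid_morphism.

Lemma fcoefCM c f n : fcoef (fpsC c * f) n = c * fcoef f n.
Proof.
rewrite fcoefM big_ord_recl /= subn0 big1 ?addr0 // => i _.
by rewrite mul0r.
Qed.

Lemma fcoef_exp_lt f n j : fcoef f 0 = 0 -> (n < j)%N -> fcoef (f ^+ j) n = 0.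
Proof.
move=> f0; elim: j n => // j IHj n; rewrite ltnS exprS fcoefM => nj.
rewrite big_ord_recl f0 mul0r add0r big1 // => i _.
rewrite IHj ?mulr0 //= /bump leq0n add1n.
by rewrite (leq_trans _ nj) // ltn_subrL; case: n i {nj} => [[]|].
Qed.

End Multiplicative.

Section Units.
Variable R : comUnitRingType.
Implicit Types f g : fps R.

Definition fps_unit : pred (fps R) := fun f => fcoef f 0 \is a GRing.unit.

(* Geometric series: f^-1 = c^-1 * \sum_j (1 - c^-1 f)^j, c the constant term. *)
Definition fps_inv f : fps R :=
  if fps_unit f then
    let c := fcoef f 0 in
    Fps (fun n => c^-1 * \sum_(j < n.+1) fcoef ((1 - fpsC c^-1 * f) ^+ j) n)
  else f.

Lemma fps_mulVf : {in fps_unit, left_inverse 1 fps_inv *%R}.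
Proof.
move=> f uf; rewrite /fps_inv (uf : fps_unit f).
set c := fcoef f 0; set g := 1 - fpsC c^-1 * f.
have uc : c \is a GRing.unit by [].
have g0 : fcoef g 0 = 0.
  by rewrite /g fcoefD fcoefN fcoefCM -/c mulVr ?fcoef1 ?subrr.
have fE : f = fpsC c * (1 - g).
  by rewrite /g opprB addrC subrK mulrA -rmorphM mulrV ?rmorph1 ?mul1r.
pose G n : fps R := \sum_(j < n.+1) g ^+ j.
have GE n m : (m <= n)%N ->
    \sum_(j < m.+1) fcoef (g ^+ j) m = fcoef (G n) m.
  move=> mn; rewrite fcoef_sum.
  rewrite (big_ord_widen n.+1 (fun j => fcoef (g ^+ j) m)) ?ltnS //.
  rewrite big_mkcond; apply: eq_bigr => j _.
  by case: ltnP => // mj; rewrite fcoef_exp_lt.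
apply: fpsP => n; rewrite fcoefM.
transitivity (fcoef (fpsC c^-1 * G n * f) n).
  rewrite fcoefM; apply: eq_bigr => i _.
  by rewrite fcoefCM /= -GE // -ltnS.
rewrite {1}fE mulrACA -rmorphM mulVr // rmorph1 mul1r mulrC -[1 - g]opprB mulNr.
by rewrite -subrX1 opprB fcoefD fcoefN (@fcoef_exp_lt _ g n n.+1) ?subr0.
Qed.

Lemma fps_unitPl f g : g * f = 1 -> fps_unit f.
Proof.
move=> /(congr1 (fun h => fcoef h 0)).
rewrite fcoefM big_ord1 fcoef1 /= => gf1.
by apply/unitrPr; exists (fcoef g 0); rewrite mulrC.
Qed.

Lemma fps_inv_out : {in [predC fps_unit], fps_inv =1 id}.
Proof.
by move=> f nuf; rewrite /fps_inv ifF //; apply: negbTE; rewrite inE in nuf.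
Qed.

HB.instance Definition _ := GRing.ComNzRing_hasMulInverse.Build (fps R)
  fps_mulVf fps_unitPl fps_inv_out.

End Units.
End FpsRing.

Definition fpsX (R : pzSemiRingType) : fps R := Fps (fun n => (n == 1%N)%:R).
Arguments fpsX {R}.

Definition fps_of_poly (R : nzSemiRingType) (p : {poly R}) : fps R :=
  Fps (fun n => p`_n).

(* The quotient by t^d, exact when the first d coefficients vanish. *)
Definition fps_divX (R : Type) (d : nat) (f : fps R) : fps R :=
  Fps (fun n => fcoef f (n + d)).

Definition gbinom (a : rat) (j : nat) : rat :=
  (\prod_(i < j) (a - i%:R)) / j`!%:R.

(* f^a = \sum_j binom(a, j) (f - 1)^j for f with constant term 1; since
   (f - 1)^j = O(t^j), only j <= n contributes to the coefficient of t^n.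
   The coefficient ring is meant to contain the rationals. *)
Definition fps_pow (R : comUnitRingType) (f : fps R) (a : rat) : fps R :=
  Fps (fun n => \sum_(j < n.+1) ratr (gbinom a j) * fcoef ((f - 1) ^+ j) n).

Definition fps_exp : fps rat := Fps (fun n => n`!%:R^-1).

(** * Bivariate series *)

(* Q[[x]][[z]]: the coefficients of the outer series (in z) are series in x.
   All the series raised to a fractional power below have constant term 1 with
   respect to the outer variable. *)
Definition fps2 := fps (fps rat).

Definition lift_x (f : fps rat) : fps2 := fpsC f.
Definition lift_z (f : fps rat) : fps2 := fps_map (@fpsC rat) f.

Definition xcoef (j : nat) (F : fps2) : fps rat :=
  fps_map (fun f : fps rat => fcoef f j) F.

(** * Multigraphs *)

(* n vertices and m labelled oriented edges: the edge labelled e goes from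
   (G e).1 to (G e).2. *)
Definition multigraph (n m : nat) := {ffun 'I_m -> 'I_n * 'I_n}.

Definition adjacent n m (G : multigraph n m) : rel 'I_n :=
  fun v w => [exists e, (G e == (v, w)) || (G e == (w, v))].

Definition component n m (G : multigraph n m) (v : 'I_n) : {set 'I_n} :=
  [set w | connect (adjacent G) v w].

Definition edges_in n m (G : multigraph n m) (C : {set 'I_n}) : {set 'I_m} :=
  [set e | ((G e).1 \in C) && ((G e).2 \in C)].

Definition component_excess n m (G : multigraph n m) (v : 'I_n) : int :=
  #|edges_in G (component G v)|%:Z - #|component G v|%:Z.

Definition positive n m : pred (multigraph n m) :=
  fun G => [forall v, 0 < component_excess G v].

(* A multigraph of excess k >= 0 with n vertices has n + k edges. *)
Definition multigraph_gf (F : forall n m, pred (multigraph n m)) (k : nat) :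
    fps rat :=
  Fps (fun n => \sum_(G : multigraph n (n + k) | F n (n + k)%N G)
    ((2 ^ (n + k) * (n + k)`!)%N%:R^-1 / n`!%:R)).

Definition MGpos (k : nat) : fps rat := multigraph_gf positive k.

(** * The closed forms *)

Definition Tree : fps rat :=
  Fps (fun n => if n == 0%N then 0 else (n ^ n.-1)%N%:R / n`!%:R).

Definition odd_fact (k : nat) : rat := (2 * k)`!%:R / (2 ^ k * k`!)%N%:R.

(* (e^x - 1 - x) / (x^2/2) *)
Definition exp_rem2 : fps rat := 2%:R * fps_divX 2 (fps_exp - 1 - fpsX).

(* (e^x - 1 - x - x^2/2) / (x^2/2) *)
Definition exp_rem3 : fps rat :=
  2%:R * fps_divX 2 (fps_exp - 1 - fpsX - fpsX ^+ 2 / 2%:R).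

Definition B : fps2 := (1 - lift_z Tree * lift_x exp_rem2)^-1.

(* Here the outer variable is T. *)
Definition MK_series (k : nat) : fps rat :=
  fpsC (odd_fact k) * (1 - fpsX) ^+ (2 * k) *
  xcoef (2 * k)
    (fps_pow (1 - lift_z (fpsX / (1 - fpsX)) * lift_x exp_rem3)
             (- k%:R - 2%:R^-1)).

Definition eval_at_Tree (p : {poly rat}) : fps rat :=
  (map_poly (@fpsC rat) p).[Tree].

(* Main.v *)
From HB Require Import structures.
Require Import Defs.
From mathcomp Require Import all_boot all_order all_algebra.
From mathcomp Require Import ring zify.

Set Implicit Arguments.
Unset Strict Implicit.
Unset Printing Implicit Defensive.

Import Order.TTheory GRing.Theory Num.Theory.
Local Open Scope ring_scope.

(** Every multigraph is the disjoint union of its positive components and of the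
    others, so that, for exponential weights, the array of all multigraphs,
    indexed by numbers of vertices and edges, is the convolution of the array
    of positive multigraphs with that of multigraphs whose components all have
    excess at most 0 ([multigraph_split]). The first array lives on positive
    excess, apart from the empty multigraph, and the second one on excess at
    most 0. Such a factorisation is unique ([factorisation_uniq]), so it is
    enough to produce an explicit one.

    The explicit factorisation is written in terms of the tree series [T]. Let
    [treeless K] be the series obtained from the multigraphs of excess [K] and
    minimal degree at least 2 by giving each vertex the weight [T]. Pairing half-edges
    gives it as
    [(2 K - 1)!! [x ^ (2 K)] (1 - T (exp x - 1 - x) / (x ^ 2 / 2)) ^ (- K - 1/2)]
    ([treeless_pow]). The weights of all multigraphs of excess [k] are the sum
    over [t] of [(T - T ^ 2 / 2) ^ t / t! * treeless (k + t)]
    ([sum_unrooted_treeless]). To see it, consider [T] as a variable and put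
    [z = T exp (- T)], which is legitimate because [Tree] is the compositional
    inverse of [T exp (- T)] ([tree_inv_Tree]). The binomial theorem
    merges [T - T ^ 2 / 2] with [T (exp x - 1 - x)] into
    [T (exp x - x) - T ^ 2 / 2]; expanding in powers of [exp x] and comparing
    coefficients, one is left with the coefficients of
    [(1 + 2 x) ^ K = ((1 + x) ^ 2 - x ^ 2) ^ K] ([bin_identity]). As
    [treeless 0 = (1 - T) ^ (-1/2)], the quotient
    [sqrt (1 - T) * treeless k] has excess 0 part equal to 1, and therefore is
    the series of positive multigraphs ([MGpos_closed]); this is the second
    expression.

    The first one follows by factoring [1 - T] out of the base of the power
    ([sqrt_treeless_kernel]): the remaining series in [x] has no constant term,
    so only finitely many powers of [T / (1 - T)] occur, and a polynomial in [T]
    appears.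

    The degree of this polynomial is the delicate point: its leading coefficient
    is an alternating sum, up to sign a coefficient of the Stirling series. Its
    terms are [S (2 (j + k), j) / (2 ^ (j + k) (j + k)!)] for [j <= 2 k], where
    [S (N, j)] is the number of partitions of an [N]-set into [j] blocks of size
    at least 3. The term [j = 2 k] has a larger power of 3 in its denominator
    than all the others ([kernel_poly_lead_neq0]), so the sum is not 0. *)

(** * Derivatives and shifts of power series *)

Section Derivative.
Variable R : comNzRingType.
Implicit Types f g : fps R.

Definition fps_deriv f : fps R := Fps (fun n => fcoef f n.+1 *+ n.+1).

Lemma fcoef_deriv f n : fcoef (fps_deriv f) n = fcoef f n.+1 *+ n.+1.
Proof. by []. Qed.

Lemma fps_derivD f g : fps_deriv (f + g) = fps_deriv f + fps_deriv g.
Proof. by apply: fpsP => n; rewrite /= mulrnDl. Qed.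

Lemma fps_derivC c : fps_deriv (fpsC c) = 0.
Proof. by apply: fpsP => n; rewrite fcoef0 /= mul0rn. Qed.

Lemma fps_derivM f g :
  fps_deriv (f * g) = fps_deriv f * g + f * fps_deriv g.
Proof.
apply: fpsP => n; rewrite fcoefD !fcoefM /fps_deriv [LHS]/= -sumrMnl.
pose u i := fcoef f i * fcoef g (n.+1 - i).
transitivity (\sum_(i < n.+2) u i *+ i + \sum_(i < n.+2) u i *+ (n.+1 - i)).
  rewrite -big_split; apply: eq_bigr => i _ /=.
  by rewrite -mulrnDr subnKC // -ltnS.
congr (_ + _).
  rewrite big_ord_recl mulr0n add0r.
  by apply: eq_bigr => i _; rewrite /u /= mulrnAl.
rewrite big_ord_recr /= subnn mulr0n addr0.
by apply: eq_bigr => i _; rewrite /u /= -mulrnAr -subSn // -ltnS.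
Qed.

Lemma fps_derivX f n : fps_deriv (f ^+ n.+1) = f ^+ n * fps_deriv f *+ n.+1.
Proof.
elim: n => [|n IHn]; first by rewrite mul1r.
rewrite exprS fps_derivM IHn -mulrnAr mulrA -exprS mulrC mulrnAr [RHS]mulrS.
by congr (_ + _); rewrite mulrC.
Qed.

Lemma fcoef_mulX f n : fcoef (fpsX * f) n.+1 = fcoef f n.
Proof.
rewrite fcoefM big_ord_recl big_ord_recl /= mul0r add0r mul1r subSS subn0.
by rewrite big1 ?addr0 // => i _; rewrite mul0r.
Qed.

Lemma fcoef_mulX0 f : fcoef (fpsX * f) 0 = 0.
Proof. by rewrite fcoefM big_ord1 /= mul0r. Qed.

Lemma fcoef_mulXn f d n :
  fcoef (fpsX ^+ d * f) n = if (d <= n)%N then fcoef f (n - d) else 0.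
Proof.
elim: d n => [|d IHd] [|n]; rewrite ?mul1r ?subn0 // exprS -mulrA.
  by rewrite fcoef_mulX0.
by rewrite fcoef_mulX IHd.
Qed.

Lemma fcoef_fpsXn n i : fcoef (fpsX ^+ n : fps R) i = (i == n)%:R.
Proof.
by rewrite -[_ ^+ _]mulr1 fcoef_mulXn fcoef1 subn_eq0; case: ltngtP.
Qed.

Lemma fcoef0M f g : fcoef (f * g) 0 = fcoef f 0 * fcoef g 0.
Proof. by rewrite fcoefM big_ord1. Qed.

Lemma fcoef0X f n : fcoef (f ^+ n) 0 = fcoef f 0 ^+ n.
Proof. by elim: n => // n IHn; rewrite !exprS fcoef0M IHn. Qed.

Lemma fcoef_exp_diag f n : fcoef f 0 = 0 -> fcoef (f ^+ n) n = fcoef f 1 ^+ n.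
Proof.
move=> f0; elim: n => // n IHn; rewrite exprS fcoefM big_ord_recl f0 mul0r add0r.
rewrite big_ord_recl /= subSS subn0 IHn -exprS big1 ?addr0 // => i _.
rewrite fcoef_exp_lt ?mulr0 //= /bump /=; have := ltn_ord i; lia.
Qed.

Lemma fcoefMn f k n : fcoef (f *+ k) n = fcoef f n *+ k.
Proof. by elim: k => [|k IHk]; rewrite ?fcoef0 // !mulrS fcoefD IHk. Qed.

Lemma fcoefZn f k n : fcoef (k%:R * f) n = k%:R * fcoef f n.
Proof. by rewrite !mulr_natl fcoefMn. Qed.

End Derivative.

(** * Composition of power series *)

Section Composition.
Variables (K R : comNzRingType) (iota : {rmorphism K -> R}).
Implicit Types (f : fps K) (g : fps R).

(** Substitution of [g] for the variable of [f], meant for [g] with constant term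
    0: then [g ^+ j] only has terms of degree at least [j], which is why the sum
    stops at [n]. *)
Definition fps_comp f g : fps R :=
  Fps (fun n => \sum_(j < n.+1) iota (fcoef f j) * fcoef (g ^+ j) n).

Lemma fcoef_comp f g n : fcoef (fps_comp f g) n =
  \sum_(j < n.+1) iota (fcoef f j) * fcoef (g ^+ j) n.
Proof. by []. Qed.

(** Up to a given degree composition is evaluation of a polynomial; this is how
    it inherits multiplicativity. *)
Lemma fps_comp_poly f (p : {poly K}) g n : fcoef g 0 = 0 ->
    (forall i, (i <= n)%N -> fcoef f i = p`_i) ->
  fcoef (fps_comp f g) n = fcoef (map_poly (@fpsC R \o iota) p).[g] n.
Proof.
move=> g0 fp; set N := maxn n.+1 (size p).
rewrite (@horner_coef_wide _ N); last first.
  by rewrite (leq_trans (size_poly _ _)) // leq_maxr.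
rewrite fcoef_sum [LHS]/= (big_ord_widen N
  (fun j => iota (fcoef f j) * fcoef (g ^+ j) n)) ?leq_maxl // big_mkcond.
apply: eq_bigr => j _; rewrite coef_map fcoefCM.
case: ltnP => jn; first by rewrite fp.
by rewrite fcoef_exp_lt ?mulr0.
Qed.

Variables (g : fps R) (g0 : fcoef g 0 = 0).

Lemma fps_compD f1 f2 : fps_comp (f1 + f2) g = fps_comp f1 g + fps_comp f2 g.
Proof.
apply: fpsP => n; rewrite fcoefD !fcoef_comp -big_split.
by apply: eq_bigr => j _; rewrite fcoefD rmorphD mulrDl.
Qed.

Lemma fps_comp_sum (I : Type) (r : seq I) (P : pred I) (F : I -> fps K) :
  fps_comp (\sum_(i <- r | P i) F i) g = \sum_(i <- r | P i) fps_comp (F i) g.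
Proof.
apply: (big_morph (fps_comp^~ g) fps_compD).
apply: fpsP => n; rewrite fcoef0 fcoef_comp big1 // => j _.
by rewrite fcoef0 rmorph0 mul0r.
Qed.

Lemma fps_compCM c f : fps_comp (fpsC c * f) g = fpsC (iota c) * fps_comp f g.
Proof.
apply: fpsP => n; rewrite fcoefCM !fcoef_comp mulr_sumr.
by apply: eq_bigr => j _; rewrite fcoefCM rmorphM mulrA.
Qed.

Lemma fps_comp1 : fps_comp 1 g = 1.
Proof.
apply: fpsP => n; rewrite /= big_ord_recl /= rmorph1 mul1r big1 ?addr0 //.
by move=> i _; rewrite rmorph0 mul0r.
Qed.

Lemma fps_compX : fps_comp fpsX g = g.
Proof.
apply: fpsP => -[|n]; first by rewrite /= big_ord1 rmorph0 mul0r.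
rewrite /= big_ord_recl big_ord_recl /= rmorph0 mul0r add0r rmorph1 mul1r.
by rewrite big1 ?addr0 // => i _; rewrite mul0r.
Qed.

Lemma fps_compM f1 f2 : fps_comp (f1 * f2) g = fps_comp f1 g * fps_comp f2 g.
Proof.
apply: fpsP => n.
have E f i : (i <= n)%N -> fcoef (fps_comp f g) i =
    fcoef (map_poly (@fpsC R \o iota) (fps_trunc n.+1 f)).[g] i.
  move=> lin; apply: fps_comp_poly => // j lji.
  by rewrite coef_poly ltnS (leq_trans lji lin).
rewrite (@fps_comp_poly _ (fps_trunc n.+1 f1 * fps_trunc n.+1 f2)) //; last first.
  by move=> i lin; rewrite -fcoef_mul_trunc // ltnS.
rewrite rmorphM hornerM !fcoefM; apply: eq_bigr => i _.
by rewrite !E ?leq_subr // -ltnS.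
Qed.

Lemma fps_compXn f n : fps_comp (f ^+ n) g = fps_comp f g ^+ n.
Proof. by elim: n => [|n IHn]; rewrite ?fps_comp1 // !exprS fps_compM IHn. Qed.

Lemma fps_deriv_comp f :
  fps_deriv (fps_comp f g) = fps_comp (fps_deriv f) g * fps_deriv g.
Proof.
apply: fpsP => n; rewrite fcoefM.
transitivity (\sum_(j < n.+1) iota (fcoef (fps_deriv f) j)
    * fcoef (g ^+ j * fps_deriv g) n).
  rewrite fcoef_deriv fcoef_comp -sumrMnl big_ord_recl expr0 fcoef1 mulr0.
  rewrite mul0rn add0r; apply: eq_bigr => j _.
  rewrite -mulrnAr -fcoef_deriv fps_derivX fcoefMn fcoef_deriv rmorphMn.
  by rewrite mulrnAl mulrnAr.
under eq_bigr do rewrite fcoefM mulr_sumr.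
rewrite exchange_big; apply: eq_bigr => i _.
rewrite fcoef_comp mulr_suml (big_ord_widen n.+1 (fun j =>
  iota (fcoef (fps_deriv f) j) * fcoef (g ^+ j) i
  * fcoef (fps_deriv g) (n - i))) ?ltn_ord //.
rewrite [RHS]big_mkcond; apply: eq_bigr => j _; rewrite mulrA.
by case: ltnP => // lij; rewrite fcoef_exp_lt // mulr0 mul0r.
Qed.

End Composition.

Lemma fps_comp_fpsX (R : comNzRingType) (f : fps R) :
  fps_comp idfun f fpsX = f.
Proof.
apply: fpsP => n; rewrite fcoef_comp big_ord_recr /= fcoef_fpsXn eqxx mulr1.
by rewrite big1 ?add0r // => j _; rewrite fcoef_fpsXn gtn_eqF ?mulr0.
Qed.

Lemma fps_compA (R : comNzRingType) (f g h : fps R) :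
    fcoef g 0 = 0 -> fcoef h 0 = 0 ->
  fps_comp idfun (fps_comp idfun f g) h = fps_comp idfun f (fps_comp idfun g h).
Proof.
move=> g0 h0.
have gh0 : fcoef (fps_comp idfun g h) 0 = 0 by rewrite /= big_ord1 g0 mul0r.
apply: fpsP => n; rewrite [RHS]/=.
under [RHS]eq_bigr do rewrite -fps_compXn // -fcoefCM.
rewrite -fcoef_sum; under eq_bigr do rewrite -(fps_compCM idfun).
rewrite -fps_comp_sum; apply: eq_bigr => i _; congr (_ * _).
rewrite fcoef_sum [LHS]fcoef_comp (big_ord_widen n.+1
  (fun j => fcoef f j * fcoef (g ^+ j) i)) ?ltn_ord //.
rewrite big_mkcond; apply: eq_bigr => j _; rewrite fcoefCM.
by case: ltnP => // lij; rewrite fcoef_exp_lt ?mulr0.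
Qed.

(** A series tangent to the identity is right cancellable for composition: the
    lowest coefficient in which two series differ survives. *)
Lemma fps_comp_inj (R : comNzRingType) (g : fps R) :
  fcoef g 0 = 0 -> fcoef g 1 = 1 -> injective ((fps_comp idfun)^~ g).
Proof.
move=> g0 g1 f1 f2 /= eqf; apply: fpsP => n.
elim/ltn_ind: n => n IHn.
move/(congr1 (fun f => fcoef f n)): eqf; rewrite /= !big_ord_recr /=.
rewrite fcoef_exp_diag // g1 expr1n !mulr1.
under eq_bigr do rewrite IHn ?ltn_ord //.
exact: addrI.
Qed.

(** * Rational powers of power series *)

Lemma gbinomS a j : gbinom a j.+1 * j.+1%:R = gbinom a j * (a - j%:R).
Proof.
rewrite /gbinom big_ord_recr /= factS natrM.
have := fact_gt0 j; rewrite -(ltr0n rat) => /lt0r_neq0 fj; field.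
by rewrite fj nat1r pnatr_eq0.
Qed.

Lemma gbinom0 a : gbinom a 0 = 1.
Proof. by rewrite /gbinom big_ord0 fact0 divr1. Qed.

Definition binomial_series (a : rat) : fps rat := Fps (gbinom a).

Lemma fcoef_binomial a n : fcoef (binomial_series a) n = gbinom a n.
Proof. by []. Qed.

(** The equation [(1 + x) y' = a y] characterises [(1 + x) ^ a]. *)
Lemma binomial_series_ode a :
  (1 + fpsX) * fps_deriv (binomial_series a) = fpsC a * binomial_series a.
Proof.
apply: fpsP => n; rewrite mulrDl mul1r fcoefD fcoefCM fcoef_deriv.
rewrite -mulr_natr !fcoef_binomial gbinomS; case: n => [|n].
  by rewrite fcoef_mulX0 subr0 addr0 mulrC.
by rewrite fcoef_mulX fcoef_deriv fcoef_binomial -mulr_natr; ring.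
Qed.

(** All rational powers are handled through the linear equation
    [F * Y' = G * Y]: its solutions are determined by their constant term when
    [F] has constant term 1 and integers are invertible. *)
Lemma fps_linear_ode_uniq (R : comNzRingType) (iota : {rmorphism rat -> R})
    (F G Y Z : fps R) :
    fcoef F 0 = 1 -> F * fps_deriv Y = G * Y -> F * fps_deriv Z = G * Z ->
  fcoef Y 0 = fcoef Z 0 -> Y = Z.
Proof.
move=> F0 odeY odeZ YZ0; apply: fpsP; elim/ltn_ind => -[//|n] IHn.
have divn (x : R) : x *+ n.+1 = 0 -> x = 0.
  move=> xn; rewrite -[x]mulr1 -(rmorph1 iota).
  rewrite -(@mulVf _ n.+1%:R) ?pnatr_eq0 // rmorphM rmorph_nat mulrCA mulr_natr.
  by rewrite xn mulr0.
apply/eqP; rewrite -subr_eq0; apply/eqP/divn; rewrite mulrnBl -!fcoef_deriv.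
have: fcoef (F * fps_deriv Y) n - fcoef (F * fps_deriv Z) n = 0.
  rewrite odeY odeZ !fcoefM -sumrB big1 // => i _.
  by rewrite IHn ?subrr // ltnS leq_subr.
rewrite !fcoefM -sumrB big_ord_recl F0 !mul1r subn0 big1 ?addr0 // => i _.
rewrite !fcoef_deriv IHn ?subrr //.
rewrite ltnS [val _]/= /bump; have := ltn_ord i; lia.
Qed.

Section Pow.
Variables (R : comUnitRingType) (iota : {rmorphism rat -> R}).
(* [ratr] is a morphism only into rings containing the rationals. *)
Hypothesis ratrE : ratr =1 iota.
Implicit Types F G : fps R.

Lemma fps_powE F a : fps_pow F a = fps_comp iota (binomial_series a) (F - 1).
Proof. by apply: fpsP => n /=; apply: eq_bigr => j _; rewrite ratrE. Qed.

Lemma fcoef_subr1 F : fcoef F 0 = 1 -> fcoef (F - 1) 0 = 0.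
Proof. by move=> F0; rewrite fcoefD fcoefN F0 fcoef1 subrr. Qed.

Lemma fcoef0_pow F a : fcoef (fps_pow F a) 0 = 1.
Proof. by rewrite fps_powE fcoef_comp big_ord1 /= gbinom0 rmorph1 mul1r. Qed.

Lemma fps_deriv_pow F a : fcoef F 0 = 1 ->
  F * fps_deriv (fps_pow F a) = fpsC (iota a) * fps_deriv F * fps_pow F a.
Proof.
move=> /[dup] F0 /fcoef_subr1 F10; rewrite fps_powE fps_deriv_comp // mulrA.
have -> : fps_deriv (F - 1) = fps_deriv F.
  by rewrite fps_derivD -(rmorphN1 (@fpsC R)) fps_derivC addr0.
have {1}-> : F = fps_comp iota (1 + fpsX) (F - 1).
  by rewrite fps_compD fps_comp1 fps_compX // addrCA subrr addr0.
by rewrite -fps_compM // binomial_series_ode fps_compCM mulrAC.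
Qed.

Lemma fps_pow_ode_uniq F Y a : fcoef F 0 = 1 -> fcoef Y 0 = 1 ->
  F * fps_deriv Y = fpsC (iota a) * fps_deriv F * Y -> fps_pow F a = Y.
Proof.
move=> F0 Y0 odeY; apply: (fps_linear_ode_uniq iota F0 _ odeY).
  exact: fps_deriv_pow.
by rewrite fcoef0_pow.
Qed.

Lemma fps_powD F a b : fcoef F 0 = 1 ->
  fps_pow F (a + b) = fps_pow F a * fps_pow F b.
Proof.
move=> F0; apply: fps_pow_ode_uniq => //.
  by rewrite fcoef0M !fcoef0_pow mulr1.
rewrite fps_derivM mulrDr mulrA fps_deriv_pow // mulrCA fps_deriv_pow //.
by rewrite !rmorphD; ring.
Qed.

(** Both sides solve [F G Y' = a (F G)' Y]. *)
Lemma fps_powM F G a : fcoef F 0 = 1 -> fcoef G 0 = 1 ->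
  fps_pow (F * G) a = fps_pow F a * fps_pow G a.
Proof.
move=> F0 G0; apply: fps_pow_ode_uniq.
- by rewrite fcoef0M F0 G0 mulr1.
- by rewrite fcoef0M !fcoef0_pow mulr1.
have shuffle (A : comNzRingType) (f g p q c f' g' p' q' : A) :
    f * p' = c * f' * p -> g * q' = c * g' * q ->
  f * g * (p' * q + p * q') = c * (f' * g + f * g') * (p * q).
  move=> fp gq; transitivity ((f * p') * (g * q) + (f * p) * (g * q')).
    by ring.
  by rewrite fp gq; ring.
by rewrite !fps_derivM; apply: shuffle; apply: fps_deriv_pow.
Qed.

Lemma fps_pow_nat F k : fcoef F 0 = 1 -> fps_pow F k%:R = F ^+ k.
Proof.
move=> F0; apply: fps_pow_ode_uniq => //.
  by rewrite fcoef0X F0 expr1n.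
case: k => [|k]; last first.
  by rewrite fps_derivX !rmorph_nat -mulr_natl exprS; ring.
by rewrite expr0 -(rmorph1 (@fpsC R)) fps_derivC !rmorph0 mulr0 !mul0r.
Qed.

Lemma fps_powN F a : fcoef F 0 = 1 -> fps_pow F a * fps_pow F (- a) = 1.
Proof. by move=> F0; rewrite -fps_powD // subrr (fps_pow_nat 0). Qed.

Lemma fps_unit1 F : fcoef F 0 = 1 -> F \is a GRing.unit.
Proof. by move=> F0; rewrite unfold_in /= /fps_unit F0 unitr1. Qed.

Lemma fps_pow1 a : fps_pow 1 a = 1 :> fps R.
Proof.
apply: fps_pow_ode_uniq; rewrite ?fcoef1 //.
by rewrite -(rmorph1 (@fpsC R)) !fps_derivC !mulr0 mul0r.
Qed.

Lemma fcoef0_inv F : fcoef F 0 = 1 -> fcoef F^-1 0 = 1.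
Proof.
move=> F0; rewrite -[LHS]mul1r -{1}F0 -fcoef0M divrr ?fcoef1 //.
exact: fps_unit1.
Qed.

Lemma fps_powV F a : fcoef F 0 = 1 -> fps_pow F^-1 a = fps_pow F (- a).
Proof.
move=> F0; rewrite -[LHS]mul1r -(fps_powN (- a) F0) opprK -mulrA.
rewrite -fps_powM ?fcoef0_inv // divrr ?fps_pow1 ?mulr1 //.
exact: fps_unit1.
Qed.

End Pow.

(** * Bivariate series *)

Lemma ratr_id_rat : (ratr : rat -> rat) =1 idfun.
Proof. by move=> q; rewrite /ratr divq_num_den. Qed.

Lemma ratr_fpsC : (ratr : rat -> fps rat) =1 @fpsC rat.
Proof. by move=> q; rewrite -[in RHS](divq_num_den q) fmorph_div !rmorph_int. Qed.

Lemma fcoef_lift_z f n : fcoef (lift_z f) n = fpsC (fcoef f n).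
Proof. by []. Qed.

Lemma lift_z_zmod : zmod_morphism lift_z.
Proof. by move=> f g; apply: fpsP => n; rewrite fcoef_lift_z rmorphB. Qed.

Lemma lift_z_monoid : monoid_morphism lift_z.
Proof.
split=> [|f g]; apply: fpsP => n.
  by rewrite fcoef_lift_z !fcoef1 rmorph_nat.
rewrite fcoef_lift_z !fcoefM rmorph_sum; apply: eq_bigr => i _.
exact: rmorphM.
Qed.

HB.instance Definition _ :=
  GRing.isZmodMorphism.Build (fps rat) fps2 lift_z lift_z_zmod.
HB.instance Definition _ :=
  GRing.isMonoidMorphism.Build (fps rat) fps2 lift_z lift_z_monoid.

Lemma lift_z_pow f a : lift_z (fps_pow f a) = fps_pow (lift_z f) a.
Proof.
apply: fpsP => n; rewrite fcoef_lift_z [LHS]rmorph_sum; apply: eq_bigr => j _.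
rewrite rmorphM ratr_fpsC ratr_id_rat -(rmorph1 lift_z) -rmorphB -rmorphXn.
by [].
Qed.

Lemma fcoef_xcoef j F n : fcoef (xcoef j F) n = fcoef (fcoef F n) j.
Proof. by []. Qed.

Lemma xcoef_lift_zM j f F : xcoef j (lift_z f * F) = f * xcoef j F.
Proof.
apply: fpsP => n; rewrite fcoef_xcoef !fcoefM fcoef_sum.
by apply: eq_bigr => i _; rewrite fcoef_lift_z fcoefCM.
Qed.

Lemma xcoef_lift_xz j r f : xcoef j (lift_z f * lift_x r) = fpsC (fcoef r j) * f.
Proof.
rewrite xcoef_lift_zM mulrC; congr (_ * _).
by apply: fpsP => -[|n]; rewrite fcoef_xcoef /= ?if_same.
Qed.

(** The [j]-th term of the binomial expansion is divisible by [z ^ j]. *)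
Lemma fcoef_xcoef_pow h r a N n : fcoef h 0 = 0 ->
  fcoef (xcoef N (fps_pow (1 - lift_z h * lift_x r) a)) n =
  \sum_(j < n.+1) (-1) ^+ j * gbinom a j * fcoef (r ^+ j) N * fcoef (h ^+ j) n.
Proof.
move=> h0; rewrite fcoef_xcoef /= fcoef_sum; apply: eq_bigr => j _.
rewrite ratr_fpsC fcoefCM -fcoef_xcoef addrAC subrr sub0r.
rewrite [in LHS]exprNn [in LHS]exprMn.
rewrite -!rmorphXn -(rmorph_sign lift_z) mulrA -rmorphM xcoef_lift_xz fcoefCM.
by rewrite -(rmorph_sign (@fpsC rat)) fcoefCM; ring.
Qed.

(** When [r] has no constant term only finitely many powers of [h] reach the
    coefficient of [x ^ N]. *)
Lemma xcoef_pow_fin h r a N : fcoef h 0 = 0 -> fcoef r 0 = 0 ->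
  xcoef N (fps_pow (1 - lift_z h * lift_x r) a) =
  \sum_(j < N.+1) fpsC ((-1) ^+ j * gbinom a j * fcoef (r ^+ j) N) * h ^+ j.
Proof.
move=> h0 r0; apply: fpsP => n; rewrite fcoef_xcoef_pow // fcoef_sum.
under [RHS]eq_bigr do rewrite fcoefCM.
rewrite (big_ord_widen (maxn N n).+1 (fun j => (-1) ^+ j * gbinom a j
  * fcoef (r ^+ j) N * fcoef (h ^+ j) n)) ?ltnS ?leq_maxr //.
rewrite [RHS](big_ord_widen (maxn N n).+1 (fun j => (-1) ^+ j * gbinom a j
  * fcoef (r ^+ j) N * fcoef (h ^+ j) n)) ?ltnS ?leq_maxl //.
rewrite big_mkcond [RHS]big_mkcond; apply: eq_bigr => j _ /=.
case: ltnP => nj; case: ltnP => Nj //.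
  by rewrite [fcoef (r ^+ j) N]fcoef_exp_lt ?mulr0 ?mul0r.
by rewrite [fcoef (h ^+ j) n]fcoef_exp_lt ?mulr0.
Qed.

(** * Positive and nonpositive components *)

Definition nonpositive n m : pred (multigraph n m) :=
  fun G => [forall v, component_excess G v <= 0].

Definition count_pos n m := #|[pred G : multigraph n m | positive G]|.
Definition count_nonpos n m := #|[pred G : multigraph n m | nonpositive G]|.

Section Components.
Variables (n m : nat) (G : multigraph n m).

Lemma adjacent_sym : symmetric (adjacent G).
Proof. by move=> v w; apply: eq_existsb => e; rewrite orbC. Qed.

Lemma connect_adjacent_sym : connect_sym (adjacent G).
Proof. exact: sym_connect_sym adjacent_sym. Qed.

Lemma component_refl v : v \in component G v.
Proof. by rewrite inE connect0. Qed.

Lemma component_eq v w : w \in component G v -> component G w = component G v.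
Proof.
rewrite inE => vw; apply/setP => x; rewrite !inE.
by rewrite (same_connect connect_adjacent_sym vw).
Qed.

Lemma component_sym v w : (w \in component G v) = (v \in component G w).
Proof. by rewrite !inE connect_adjacent_sym. Qed.

Lemma edge_ends_component e v :
  ((G e).1 \in component G v) = ((G e).2 \in component G v).
Proof.
have /component_eq E : (G e).2 \in component G (G e).1.
  rewrite inE connect1 //; apply/existsP; exists e.
  by rewrite -surjective_pairing eqxx.
by rewrite !(component_sym v) E.
Qed.

Lemma edge_in_component e v :
  (e \in edges_in G (component G v)) = (v \in component G (G e).1).
Proof. by rewrite inE -edge_ends_component andbb component_sym. Qed.

(** Each vertex carries an equal share of the excess of its component, so that
    a sum over components becomes a sum over vertices. *)
Lemma sum_component_excess :
  \sum_v (component_excess G v)%:~R / #|component G v|%:R = m%:R - n%:R :> rat.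
Proof.
have cardC v : #|component G v|%:R != 0 :> rat.
  by rewrite pnatr_eq0 -lt0n; apply/card_gt0P; exists v; apply: component_refl.
transitivity (\sum_v (#|edges_in G (component G v)|%:R / #|component G v|%:R
    - 1) : rat).
  apply: eq_bigr => v _; rewrite /component_excess intrD mulrDl rmorphN /=.
  by rewrite mulNr divff ?cardC.
rewrite sumrB sumr_const card_ord; congr (_ - _).
transitivity (\sum_v \sum_(e | e \in edges_in G (component G v))
    #|component G v|%:R^-1 : rat).
  by apply: eq_bigr => v _; rewrite sumr_const -[RHS]mulr_natl.
rewrite (exchange_big_dep xpredT) //= -[m in RHS]card_ord -sumr_const.
apply: eq_bigr => e _.
under eq_bigl do rewrite edge_in_component.
rewrite (eq_bigr (fun=> #|component G (G e).1|%:R^-1)) => [|v /component_eq -> //].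
by rewrite sumr_const -[LHS]mulr_natl divff.
Qed.

End Components.

(** The total excess is a sum of positive excesses. *)
Lemma count_pos_eq0 n m : (m <= n)%N || (n == 0%N) -> (0 < n + m)%N ->
  count_pos n m = 0%N.
Proof.
move=> mn nm; apply: eq_card0 => G; apply/negP; rewrite inE => /forallP posG.
have {}posG v : 0 < (component_excess G v)%:~R / #|component G v|%:R :> rat.
  rewrite divr_gt0 ?ltr0z // ltr0n; apply/card_gt0P.
  by exists v; apply: component_refl.
have := sum_component_excess G; apply/eqP.
case: n mn nm G posG => [|n] mn nm G posG.
  by rewrite big_ord0 subr0 eq_sym pnatr_eq0 -lt0n.
rewrite orbF in mn; rewrite gt_eqF // (@le_lt_trans _ _ 0) ?subr_le0 ?ler_nat //.
by rewrite big_ord_recl ltr_wpDr // sumr_ge0 // => v _; apply: ltW.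
Qed.

Lemma count_nonpos_eq0 n m : (n < m)%N -> count_nonpos n m = 0%N.
Proof.
move=> nm; apply: eq_card0 => G; apply/negP; rewrite inE => /forallP npG.
have := sum_component_excess G; apply/eqP; rewrite lt_eqF //.
rewrite (@le_lt_trans _ _ 0) ?subr_gt0 ?ltr_nat // sumr_le0 // => v _.
by rewrite mulr_le0_ge0 ?invr_ge0 // lerz0.
Qed.

(** Restriction is a relation rather than a function: the vertices and edges of
    [H] are those of [W] and [S], renumbered in increasing order, and [H] only
    exists when the edges in [S] have their ends in [W]. *)
Definition induces n m (G : multigraph n m) (W : {set 'I_n}) (S : {set 'I_m})
    (H : multigraph #|W| #|S|) :=
  [forall e, G (enum_val e) == (enum_val (H e).1, enum_val (H e).2)].

Section Induced.
Variables (n m : nat) (G : multigraph n m) (W : {set 'I_n}) (S : {set 'I_m}).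
Variable H : multigraph #|W| #|S|.
Hypothesis GH : induces G H.
Hypothesis G_out :
  forall e, e \notin S -> ((G e).1 \notin W) && ((G e).2 \notin W).

Lemma inducesE e : G (enum_val e) = (enum_val (H e).1, enum_val (H e).2).
Proof. exact/eqP/(forallP GH). Qed.

Lemma enum_valE (T : finType) (A : {set T}) x : x \in A ->
  exists i : 'I_#|A|, x = enum_val i.
Proof. by move=> xA; exists (enum_rank_in xA x); rewrite enum_rankK_in. Qed.

Lemma adjacent_induced (v w : 'I_#|W|) :
  adjacent G (enum_val v) (enum_val w) = adjacent H v w.
Proof.
apply/existsP/existsP => -[e vw].
  have eS : e \in S.
    apply: contraT => /G_out/andP[G1 _]; case/orP: vw => /eqP vw;
      by move: G1; rewrite vw enum_valP.
  have [e' eE] := enum_valE eS; exists e'; move: vw.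
  rewrite eE inducesE (surjective_pairing (H e')) !xpair_eqE.
  by rewrite !(inj_eq enum_val_inj).
exists (enum_val e); rewrite inducesE.
by case/orP: vw => /eqP ->; rewrite eqxx ?orbT.
Qed.

Lemma adjacent_closed v x : adjacent G v x -> v \in W -> x \in W.
Proof.
case/existsP=> e; case: (boolP (e \in S)) => [eS | /G_out].
  have [e' ->] := enum_valE eS; rewrite inducesE.
  by case/orP=> /eqP[<- <-]; rewrite !enum_valP.
case/andP=> /negPf G1 /negPf G2 /orP[] /eqP Ge; rewrite Ge /= in G1 G2;
  by rewrite ?G1 ?G2.
Qed.

(** No edge leaves [W], so a walk of [G] that starts in [W] is the image of a
    walk of [H]. *)
Lemma component_induced (v : 'I_#|W|) :
  component G (enum_val v) = enum_val @: component H v.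
Proof.
apply/setP => x; rewrite inE; apply/idP/imsetP => [|[w]].
  case/connectP => p; elim: p v => [|y p IHp] v /= => [_ ->|].
    by exists v; rewrite ?component_refl.
  case/andP=> vy py xE; have yW := adjacent_closed vy (enum_valP v).
  have [y' yE] := enum_valE yW; subst y.
  have [w wC ->] := IHp _ py xE; exists w => //.
  move: wC; rewrite !inE; apply: connect_trans; apply: connect1.
  by rewrite -adjacent_induced.
rewrite inE => /connectP[p]; elim: p v => [|y p IHp] v /= => [_ -> -> |].
  exact: connect0.
case/andP=> vy py wE xE; apply: (connect_trans _ (IHp _ py wE xE)).
by apply: connect1; rewrite adjacent_induced.
Qed.

Lemma edges_in_induced (C : {set 'I_#|W|}) :
  edges_in G (enum_val @: C) = enum_val @: edges_in H C.
Proof.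
apply/setP => e; apply/idP/imsetP => [|[e' e'C ->]].
  rewrite inE => eC; have eS : e \in S.
    apply/negPn/negP => /G_out/andP[/negP[]]; case/andP: eC => /imsetP[w _ ->] _.
    exact: enum_valP.
  have [e' eE] := enum_valE eS; exists e' => //; move: eC.
  by rewrite eE inducesE inE !(mem_imset _ _ enum_val_inj).
by move: e'C; rewrite !inE inducesE !(mem_imset _ _ enum_val_inj).
Qed.

Lemma component_excess_induced v :
  component_excess G (enum_val v) = component_excess H v.
Proof.
rewrite /component_excess component_induced edges_in_induced.
by rewrite !card_imset //; apply: enum_val_inj.
Qed.

End Induced.

Lemma card_rel_bij (A B : finType) (P : pred A) (Q : pred B) (R : A -> B -> bool) :
    (forall a, P a -> exists2 b, Q b & R a b) ->
    (forall b, Q b -> exists2 a, P a & R a b) ->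
    (forall a b b', R a b -> R a b' -> b = b') ->
    (forall a a' b, R a b -> R a' b -> a = a') ->
  #|P| = #|Q|.
Proof.
move=> PQ QP injB injA.
rewrite -!sum1_card; transitivity (\sum_(a in P) \sum_(b in Q | R a b) 1)%N.
  apply: eq_bigr => a /PQ[b Qb Rab]; rewrite (big_pred1 b) // => b'.
  by apply/andP/eqP => [[_ /(injB _ _ _ Rab)] // | ->].
rewrite (exchange_big_dep (mem Q)) => [|a b _ /andP[] //].
apply: eq_bigr => b /[dup] Qb /QP[a Pa Rab]; rewrite (big_pred1 a) // => a'.
apply/and3P/eqP => [[_ _ Ra'b] | -> //]; exact: injA Ra'b Rab.
Qed.

Definition positive_part n m (G : multigraph n m) :=
  [set v | 0 < component_excess G v].

Definition positive_edges n m (G : multigraph n m) :=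
  [set e | (G e).1 \in positive_part G].

Lemma edge_ends_positive n m (G : multigraph n m) e :
  ((G e).1 \in positive_part G) = ((G e).2 \in positive_part G).
Proof.
rewrite !inE /component_excess.
suff -> : component G (G e).1 = component G (G e).2 by [].
apply/esym/component_eq; rewrite -edge_ends_component; exact: component_refl.
Qed.

Lemma induces_inj n m (G : multigraph n m) (W : {set 'I_n})
    (S : {set 'I_m}) (H H' : multigraph #|W| #|S|) :
  induces G H -> induces G H' -> H = H'.
Proof.
move=> /inducesE GH /inducesE GH'; apply/ffunP => e; have := GH' e.
rewrite GH (surjective_pairing (H e)) (surjective_pairing (H' e)).
by case=> /enum_val_inj -> /enum_val_inj ->.
Qed.

Lemma induces_exists n m (G : multigraph n m) (W : {set 'I_n}) (S : {set 'I_m}) :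
    (forall e, e \in S -> ((G e).1 \in W) && ((G e).2 \in W)) ->
  exists H : multigraph #|W| #|S|, induces G H.
Proof.
move=> GS; have /fin_all_exists[H HE] (e : 'I_#|S|) :
    exists p : 'I_#|W| * 'I_#|W|, G (enum_val e) = (enum_val p.1, enum_val p.2).
  have /andP[/enum_valE[v vE] /enum_valE[w wE]] := GS _ (enum_valP e).
  by exists (v, w); rewrite -vE -wE; apply: surjective_pairing.
by exists (finfun H); apply/forallP => e; rewrite ffunE HE.
Qed.

Lemma induces_glue n m (W : {set 'I_n}) (S : {set 'I_m})
    (H : multigraph #|W| #|S|) (K : multigraph #|~: W| #|~: S|) :
  exists2 G : multigraph n m, induces G H & induces G K.
Proof.
have /fin_all_exists[G GE] (e : 'I_m) : exists p : 'I_n * 'I_n,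
    (forall i : 'I_#|S|, enum_val i = e ->
       p = (enum_val (H i).1, enum_val (H i).2)) /\
    (forall i : 'I_#|~: S|, enum_val i = e ->
       p = (enum_val (K i).1, enum_val (K i).2)).
  case: (boolP (e \in S)) => eS.
    have [i iE] := enum_valE eS; exists (enum_val (H i).1, enum_val (H i).2).
    split=> j jE; first by rewrite (enum_val_inj (etrans (esym iE) (esym jE))).
    by have := enum_valP j; rewrite jE inE eS.
  have eS' : e \in ~: S by rewrite inE.
  have [i iE] := enum_valE eS'; exists (enum_val (K i).1, enum_val (K i).2).
  split=> j jE; last by rewrite (enum_val_inj (etrans (esym iE) (esym jE))).
  by have := enum_valP j; rewrite jE (negPf eS).
exists (finfun G); apply/forallP => i; rewrite ffunE; apply/eqP.
  by case: (GE (enum_val i)) => /(_ i erefl).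
by case: (GE (enum_val i)) => _ /(_ i erefl).
Qed.

(** Prescribing the vertices [W] and the edges [S] of the positive components
    leaves an independent choice of a positive multigraph there and of a
    nonpositive one on the complements. *)
Lemma card_positive_part n m (W : {set 'I_n}) (S : {set 'I_m}) :
  #|[pred G : multigraph n m | (positive_part G == W) && (positive_edges G == S)]|
  = (count_pos #|W| #|S| * count_nonpos #|~: W| #|~: S|)%N.
Proof.
have outC (e : 'I_m) : e \notin ~: S -> e \in S by rewrite inE negbK.
rewrite /count_pos /count_nonpos -cardX.
apply: (card_rel_bij (R := fun G HK => induces G HK.1 && induces G HK.2)).
- move=> G /andP[/eqP WE /eqP SE].
  have inPos v : (v \in W) = (0 < component_excess G v) by rewrite -WE inE.
  have inW e : ((G e).1 \in W) = (e \in S) by rewrite -SE inE WE.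
  have inW2 e : ((G e).2 \in W) = (e \in S).
    by rewrite -inW -WE edge_ends_positive.
  have [H GH] : exists H : multigraph #|W| #|S|, induces G H.
    by apply: induces_exists => e eS; rewrite inW inW2 eS.
  have [K GK] : exists K : multigraph #|~: W| #|~: S|, induces G K.
    by apply: induces_exists => e; rewrite !inE inW inW2 => ->.
  exists (H, K); rewrite /= ?GH ?GK // !inE /=; apply/andP; split.
    apply/forallP => v; rewrite -(component_excess_induced GH).
      by rewrite -inPos enum_valP.
    by move=> e eS; rewrite inW inW2 eS.
  apply/forallP => v; rewrite -(component_excess_induced GK).
    by rewrite leNgt -inPos -in_setC enum_valP.
  by move=> e eS; rewrite !inE inW inW2 outC.
- move=> [H K] /andP[]; rewrite !inE /= => /forallP posH /forallP npK.
  have [G GH GK] := induces_glue H K; exists G; last by rewrite GH.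
  have inW e : ((G e).1 \in W) = (e \in S) /\ ((G e).2 \in W) = (e \in S).
    case: (boolP (e \in S)) => eS.
      by have [i ->] := enum_valE eS; rewrite (inducesE GH) !enum_valP.
    have eS' : e \in ~: S by rewrite inE.
    have [i ->] := enum_valE eS'; rewrite (inducesE GK) /=.
    have := enum_valP (K i).1; have := enum_valP (K i).2.
    by rewrite !inE => /negPf -> /negPf ->.
  have WE : positive_part G = W.
    apply/setP => v; rewrite inE; case: (boolP (v \in W)) => vW.
      have [i ->] := enum_valE vW; rewrite (component_excess_induced GH) ?posH //.
      by move=> e eS; rewrite !(inW e).1 (inW e).2 eS.
    have vW' : v \in ~: W by rewrite inE.
    have [i ->] := enum_valE vW'; apply/negbTE; rewrite -leNgt.
    rewrite (component_excess_induced GK) // => e eS.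
    by rewrite !inE (inW e).1 (inW e).2 outC.
  rewrite /= WE eqxx; apply/eqP/setP => e.
  by rewrite inE WE (inW e).1.
- move=> G [H K] [H' K'] /= /andP[GH GK] /andP[GH' GK'].
  by rewrite (induces_inj GH GH') (induces_inj GK GK').
- move=> G G' [H K] /= /andP[/inducesE GH /inducesE GK].
  move=> /andP[/inducesE GH' /inducesE GK']; apply/ffunP => e.
  case: (boolP (e \in S)) => eS.
    by have [i ->] := enum_valE eS; rewrite GH GH'.
  have eS' : e \in ~: S by rewrite inE.
  by have [i ->] := enum_valE eS'; rewrite GK GK'.
Qed.

Lemma sum_card_sets (T : finType) (F : nat -> nat) :
  (\sum_(A : {set T}) F #|A| = \sum_(i < #|T|.+1) 'C(#|T|, i) * F i)%N.
Proof.
rewrite (partition_big (fun A : {set T} => inord #|A| : 'I_#|T|.+1) xpredT) //.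
apply: eq_bigr => i _; rewrite -card_draws -sum1_card big_distrl /=.
rewrite [RHS](eq_bigl (fun A : {set T} => inord #|A| == i)) => [|A].
  by apply: eq_bigr => A /eqP <-; rewrite mul1n inordK // ltnS max_card.
by rewrite inE -val_eqE /= inordK // ltnS max_card.
Qed.

(** Grouping multigraphs by the vertices and the edges of their positive
    components. *)
Lemma multigraph_split n m :
  (n ^ (2 * m) = \sum_(i < n.+1) \sum_(j < m.+1)
    'C(n, i) * 'C(m, j) * (count_pos i j * count_nonpos (n - i) (m - j)))%N.
Proof.
have -> : (n ^ (2 * m) = #|{: multigraph n m}|)%N.
  by rewrite card_ffun card_prod !card_ord mulnn -expnM.
rewrite -sum1_card.
rewrite (partition_big (fun G => (positive_part G, positive_edges G)) xpredT) //=.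
rewrite -(pair_bigA _ (fun W S => \sum_(G : multigraph n m
  | (positive_part G, positive_edges G) == (W, S)) 1)%N) /=.
transitivity (\sum_(W : {set 'I_n}) \sum_(S : {set 'I_m})
    count_pos #|W| #|S| * count_nonpos (n - #|W|) (m - #|S|))%N.
  apply: eq_bigr => W _; apply: eq_bigr => S _; rewrite sum1_card.
  have cardC (T : finType) (A : {set T}) : (#|T| - #|A| = #|~: A|)%N.
    by rewrite -(cardsC A) addKn.
  have := cardC _ W; have := cardC _ S; rewrite !card_ord => -> ->.
  rewrite -card_positive_part; apply: eq_card => G.
  by rewrite -!topredE.
rewrite (sum_card_sets _ (fun i => \sum_(S : {set 'I_m})
  count_pos i #|S| * count_nonpos (n - i) (m - #|S|)))%N card_ord.
apply: eq_bigr => i _.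
rewrite (sum_card_sets _ (fun j => count_pos i j * count_nonpos (n - i) (m - j)))%N.
by rewrite card_ord big_distrr; apply: eq_bigr => j _; rewrite -mulnA.
Qed.

Lemma count_no_vertices : count_pos 0 0 = 1%N /\ count_nonpos 0 0 = 1%N.
Proof.
have := multigraph_split 0 0; rewrite !big_ord1 !bin0 !mul1n => /esym/eqP.
by rewrite muln0 expn0 muln_eq1 => /andP[/eqP -> /eqP ->].
Qed.

(** * Uniqueness of the factorisation *)

(** An array indexed by numbers of vertices and edges factors in at most one way
    into a part [f] of excess at most 0 and a part [g] which, apart from the
    entry 1 at the origin, has positive excess. In the convolution the row [n]
    of [f] and of [g] occurs only multiplied by the entry 1 of the other factor,
    and the supports are disjoint, so the two rows can be read off once the
    previous rows are known. *)
Lemma factorisation_uniq (f f' g g' : nat -> nat -> rat) :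
    (forall i j, (i < j)%N -> f i j = 0) ->
    (forall i j, (i < j)%N -> f' i j = 0) ->
    f 0 0 = 1 -> f' 0 0 = 1 ->
    (forall i j, (j <= i)%N || (i == 0)%N ->
       g i j = ((i == 0%N) && (j == 0%N))%:R) ->
    (forall i j, (j <= i)%N || (i == 0)%N ->
       g' i j = ((i == 0%N) && (j == 0%N))%:R) ->
    (forall n m, \sum_(i < n.+1) \sum_(j < m.+1) g i j * f (n - i)%N (m - j)%N =
                 \sum_(i < n.+1) \sum_(j < m.+1) g' i j * f' (n - i)%N (m - j)%N) ->
  forall n m, g n m = g' n m.
Proof.
move=> f_gt f'_gt f00 f'00 g_le g'_le conv n m.
have row0 (h : nat -> nat -> rat) (k : nat -> nat -> rat) p q :
    (forall i j, (j <= i)%N || (i == 0)%N ->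
       h i j = ((i == 0%N) && (j == 0%N))%:R) ->
  \sum_(j < q.+1) h 0%N j * k p (q - j)%N = k p q.
  move=> h_le; rewrite big_ord_recl h_le //= mul1r subn0 big1 ?addr0 // => j _.
  by rewrite h_le // mul0r.
have last_row (h k : nat -> nat -> rat) p q :
    (forall i j, (i < j)%N -> h i j = 0) -> h 0%N 0%N = 1 ->
  \sum_(j < q.+1) k p j * h 0%N (q - j)%N = k p q.
  move=> h_gt h00; rewrite big_ord_recr /= subnn h00 mulr1 big1 ?add0r // => j _.
  by rewrite h_gt ?mulr0 // subn_gt0.
suff: forall m, f n m = f' n m /\ g n m = g' n m by case/(_ m).
elim/ltn_ind: n {m} => -[_|n IHn] m.
  rewrite g_le ?orbT // g'_le ?orbT //; split=> //.
  case: m => [|m]; first by rewrite f00.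
  by rewrite f_gt ?f'_gt.
have := conv n.+1 m; rewrite !(big_ord_recl n.+1) !(big_ord_recr n) /=.
rewrite !subn0 !subSS !subnn.
rewrite !row0 // !last_row //.
rewrite (eq_bigr (fun i : 'I_n => \sum_(j < m.+1)
   g' (bump 0 i) j * f' (n - i)%N (m - j)%N)) => [|i _]; last first.
  apply: eq_bigr => j _; rewrite (IHn (bump 0 i) _ j).2.
    by rewrite (IHn (n - i)%N _ (m - j)%N).1 //; lia.
  by rewrite /bump; have := ltn_ord i; lia.
case: (leqP m n.+1) => mn.
  by rewrite !g_le ?g'_le ?mn //= !addr0 => /addIr.
by rewrite f_gt // f'_gt // !add0r => /addrI.
Qed.

(** * The tree function *)

Definition exp_series (c : rat) : fps rat := Fps (fun n => c ^+ n / n`!%:R).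

Lemma fact_natr_neq0 n : n`!%:R != 0 :> rat.
Proof. by rewrite pnatr_eq0 -lt0n fact_gt0. Qed.

Lemma fcoef_exp_series c n : fcoef (exp_series c) n = c ^+ n / n`!%:R.
Proof. by []. Qed.

Lemma exp_seriesE : fps_exp = exp_series 1.
Proof. by apply: fpsP => n; rewrite fcoef_exp_series expr1n mul1r. Qed.

Lemma bin_natr n i : (i <= n)%N ->
  'C(n, i)%:R = n`!%:R / (i`!%:R * (n - i)`!%:R) :> rat.
Proof.
move=> lin; rewrite -(bin_fact lin) !natrM mulfK //.
by rewrite mulf_neq0 ?fact_natr_neq0.
Qed.

Lemma exp_seriesD a b : exp_series (a + b) = exp_series a * exp_series b.
Proof.
apply: fpsP => n; rewrite fcoefM !fcoef_exp_series addrC exprDn mulr_suml.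
apply: eq_bigr => i _; rewrite !fcoef_exp_series -mulr_natr bin_natr -1?ltnS //.
have := fact_natr_neq0 i; have := fact_natr_neq0 (n - i); have := fact_natr_neq0 n.
by move=> ? ? ?; field; do !(apply/andP; split).
Qed.

Lemma exp_series0 : exp_series 0 = 1.
Proof.
apply: fpsP => n; rewrite fcoef_exp_series fcoef1 expr0n.
by case: n => [|n]; rewrite ?mul0r // fact0 divr1.
Qed.

Lemma exp_seriesX c k : exp_series c ^+ k = exp_series (k%:R * c).
Proof.
elim: k => [|k IHk]; first by rewrite mul0r exp_series0.
by rewrite exprS IHk -exp_seriesD -{1}[c]mul1r -mulrDl nat1r.
Qed.

(** [x * exp (- x)], the compositional inverse of [Tree]. *)
Definition tree_inv : fps rat := fpsX * exp_series (-1).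

Lemma tree_inv0 : fcoef tree_inv 0 = 0.
Proof. exact: fcoef_mulX0. Qed.

Lemma tree_inv1 : fcoef tree_inv 1 = 1.
Proof. by rewrite fcoef_mulX fcoef_exp_series fact0 divr1. Qed.

Lemma fcoef_tree_invX a s : fcoef (tree_inv ^+ a) s =
  if (a <= s)%N then (- a%:R) ^+ (s - a) / (s - a)`!%:R else 0.
Proof. by rewrite exprMn exp_seriesX mulrN1 fcoef_mulXn. Qed.

Lemma Tree0 : fcoef Tree 0 = 0.
Proof. by []. Qed.

(** For [n >= 2] the coefficient of [x ^ n] is an [n]-th difference of the
    polynomial [j ^ (n - 1)], which vanishes because [(exp x - 1) ^ n] is
    divisible by [x ^ n]. *)
Lemma Tree_tree_inv : fps_comp idfun Tree tree_inv = fpsX.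
Proof.
apply: fpsP => -[|[|n]].
- by rewrite fcoef_comp big_ord1 Tree0 rmorph0 mul0r.
- rewrite fcoef_comp big_ord_recl big_ord1 Tree0 rmorph0 mul0r add0r expr1.
  by rewrite tree_inv1 mulr1 /= divr1.
set N := n.+2; rewrite fcoef_comp.
have diff0 : fcoef ((- 1 + exp_series 1) ^+ N) n.+1 = 0.
  apply: fcoef_exp_lt; last exact: ltnSn.
  by rewrite fcoefD fcoefN fcoef1 fcoef_exp_series fact0 divr1 addNr.
transitivity (N%:R^-1 * fcoef ((- 1 + exp_series 1) ^+ N) n.+1); last first.
  by rewrite diff0 mulr0.
rewrite exprDn fcoef_sum mulr_sumr; apply: eq_bigr => j _.
rewrite fcoefMn exp_seriesX mulr1 -(rmorph_sign (@fpsC rat)) fcoefCM fcoef_exp_series.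
have jN : (j <= N)%N by rewrite -ltnS.
rewrite fcoef_tree_invX jN -[X in _ = _ * X]mulr_natr bin_natr //.
case: (posnP j) => [-> | j0].
  by rewrite Tree0 rmorph0 mul0r mulr0n expr0n !(mul0r, mulr0).
rewrite /= gtn_eqF // natrX [(- _) ^+ _]exprNn.
have e : (n.+1 = (N - j) + j.-1)%N by move: jN j0; rewrite /N; lia.
rewrite [in j%:R ^+ n.+1]e exprD [N`!]factS natrM.
have := fact_natr_neq0 j; have := fact_natr_neq0 (N - j); have := fact_natr_neq0 n.+1.
have N0 : N%:R != 0 :> rat by rewrite pnatr_eq0.
rewrite -/N; move: (N%:R : rat) N0 => x x0 f1 f2 f3; field.
by rewrite f1 f2 f3 x0.
Qed.

Lemma tree_inv_Tree : fps_comp idfun tree_inv Tree = fpsX.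
Proof.
apply: (fps_comp_inj tree_inv0 tree_inv1) => /=.
rewrite fps_compA ?Tree0 ?tree_inv0 // Tree_tree_inv fps_comp_fpsX fps_compX //.
exact: tree_inv0.
Qed.

(** * Binomial sums *)

Lemma eq_sum_ord (V : nmodType) (F : nat -> V) m n :
  (forall i, (minn m n <= i)%N -> F i = 0) ->
  \sum_(i < m) F i = \sum_(i < n) F i.
Proof.
move=> F0; wlog mn : m n F0 / (m <= n)%N => [H|].
  by case: (leqP m n) => [|/ltnW] mn; [|apply/esym]; apply: H; rewrite // minnC.
rewrite (big_ord_widen n F mn) big_mkcond; apply: eq_bigr => i _.
by case: ltnP => // mi; rewrite F0 ?(minn_idPl mn).
Qed.

Lemma sum_triangle (V : nmodType) (G : nat -> nat -> V) s N : (s <= N)%N ->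
    (forall t q, (s < t + q)%N -> G t q = 0) ->
  \sum_(t < N.+1) \sum_(q < N.+1) G t q =
  \sum_(p < s.+1) \sum_(q < p.+1) G (p - q)%N q.
Proof.
move=> sN G0; rewrite exchange_big /=.
transitivity (\sum_(q < N.+1) \sum_(p < s.+1)
    if (q <= p)%N then G (p - q)%N q else 0).
  apply: eq_bigr => q _; case: (leqP q s) => qs; last first.
    rewrite !big1 // => i _; last by rewrite G0 // ltn_addl.
    by rewrite leqNgt (leq_trans (ltn_ord i) qs).
  rewrite (@eq_sum_ord _ (G^~ q) N.+1 (s - q).+1) => [|i]; last first.
    by rewrite geq_min => iN; rewrite G0 //; lia.
  have -> : s.+1 = (q + (s - q).+1)%N by lia.
  rewrite big_split_ord /= [X in _ = X + _]big1 ?add0r => [|i _]; last first.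
    by rewrite leqNgt ltn_ord.
  by apply: eq_bigr => i _; rewrite leq_addr addKn.
rewrite exchange_big; apply: eq_bigr => p _.
rewrite -big_mkcond (big_ord_widen N.+1 (fun q => G (p - q)%N q)) //.
by rewrite ltnS (leq_trans _ sN) // -ltnS.
Qed.

Lemma fcoef_1DX (a : rat) n i :
  fcoef ((1 + fpsC a * fpsX) ^+ n) i = a ^+ i * 'C(n, i)%:R.
Proof.
rewrite exprDn fcoef_sum.
under eq_bigr do
  rewrite expr1n mul1r exprMn -rmorphXn fcoefMn fcoefCM fcoef_fpsXn -mulrnAr.
case: (leqP i n) => ni; last first.
  rewrite bin_small // mulr0 big1 // => j _; rewrite gtn_eqF ?mul0rn ?mulr0 //.
  exact: leq_trans (ltn_ord j) ni.
have in1 : (i < n.+1)%N by [].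
rewrite (bigD1 (Ordinal in1)) //= eqxx big1 ?addr0 // => j.
by rewrite -val_eqE /= eq_sym => /negPf ->; rewrite mul0rn mulr0.
Qed.

(** Both sides are the coefficient of [x ^ c] in
    [(1 + 2 x) ^ K = ((1 + x) ^ 2 - x ^ 2) ^ K]. *)
Lemma bin_identity K c : (2 ^ c * 'C(K, c))%:R =
  \sum_(l < K.+1) (if (2 * l <= c)%N then
    (-1) ^+ l * 'C(K, l)%:R * 'C(2 * (K - l), c - 2 * l)%:R else 0) :> rat.
Proof.
transitivity (fcoef ((1 + fpsC (2%:R : rat) * fpsX) ^+ K) c).
  by rewrite fcoef_1DX natrM natrX.
have -> : 1 + fpsC 2%:R * fpsX = - fpsX ^+ 2 + (1 + fpsC (1 : rat) * fpsX) ^+ 2.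
  by rewrite rmorph1 rmorph_nat; ring.
rewrite addrC exprDn fcoef_sum; apply: eq_bigr => l _.
rewrite fcoefMn -exprM [in LHS]exprNn -exprM mulrCA.
rewrite -(rmorph_sign (@fpsC rat)) fcoefCM [_ * fpsX ^+ _]mulrC.
rewrite fcoef_mulXn.
case: leqP => _; last by rewrite mulr0 mul0rn.
by rewrite fcoef_1DX expr1n mul1r -[LHS]mulr_natr mulrAC.
Qed.

(** [bin_identity] divided by factorials. The bounds in the conditions replace
    the vanishing of binomial coefficients, which truncated subtraction would
    not give. *)
Lemma odd_fact_bin_sum K c N : (c <= 2 * K)%N -> (c <= N)%N ->
  \sum_(l < N.+1) (if (2 * l <= c)%N && (l <= K)%N then
     (- 2%:R^-1) ^+ l / (l`!%:R * (c - 2 * l)`!%:R) * odd_fact (K - l) else 0)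
  = if (c <= K)%N then
      (2 * K - c)`!%:R / (2%:R ^+ (K - c) * (K - c)`!%:R * c`!%:R) else 0.
Proof.
move=> cK cN.
rewrite (@eq_sum_ord _ (fun l => if (2 * l <= c)%N && (l <= K)%N then
     (- 2%:R^-1) ^+ l / (l`!%:R * (c - 2 * l)`!%:R) * odd_fact (K - l) else 0)
  N.+1 K.+1); last first.
  by move=> i; rewrite geq_min => /orP iNK; case: ifP => // /andP[? ?]; case: iNK; lia.
transitivity ((2 * K - c)`!%:R / (K`!%:R * 2%:R ^+ K) * (2 ^ c * 'C(K, c))%:R : rat).
  rewrite bin_identity mulr_sumr; apply: eq_bigr => l _.
  have lK : (l <= K)%N by rewrite -ltnS.
  rewrite lK andbT; case: leqP => lc; last by rewrite mulr0.
  rewrite !bin_natr //; last by lia.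
  rewrite (_ : 2 * (K - l) - (c - 2 * l) = 2 * K - c)%N; last by lia.
  rewrite /odd_fact natrM natrX [(- 2%:R^-1) ^+ l]exprNn exprVn.
  rewrite -[in 2%:R ^+ K](subnK lK) exprD.
  have := fact_natr_neq0 (2 * K - c)%N; have := fact_natr_neq0 K; have := fact_natr_neq0 l.
  have := fact_natr_neq0 (K - l)%N; have := fact_natr_neq0 (c - 2 * l)%N.
  have p2 i : 2%:R ^+ i != 0 :> rat by rewrite expf_neq0.
  move: (p2 l) (p2 (K - l)%N) => ? ? ? ? ? ? ?; field.
  by do !(apply/andP; split).
case: leqP => cK'; last by rewrite bin_small // muln0 mulr0.
rewrite natrM natrX bin_natr // -[in 2%:R ^+ K](subnK cK') exprD.
have := fact_natr_neq0 K; have := fact_natr_neq0 c; have := fact_natr_neq0 (K - c)%N.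
have p2 i : 2%:R ^+ i != 0 :> rat by rewrite expf_neq0.
move: (p2 c) (p2 (K - c)%N) => ? ? ? ? ?; field.
by do !(apply/andP; split).
Qed.

(** * Trees, cores and all multigraphs *)

Lemma fps_divXK (R : comNzRingType) d (f : fps R) :
  (forall i, (i < d)%N -> fcoef f i = 0) -> fpsX ^+ d * fps_divX d f = f.
Proof.
move=> f0; apply: fpsP => n; rewrite fcoef_mulXn.
by case: leqP => [/subnK nd | /f0 //]; rewrite /= nd.
Qed.

Definition exp_tail2 : fps rat := fps_exp - 1 - fpsX.

Lemma exp_tail2_lt i : (i < 2)%N -> fcoef exp_tail2 i = 0.
Proof. by case: i => [|[|]] // _; rewrite /exp_tail2 !fcoefD !fcoefN fcoef1. Qed.

Lemma fcoef_exp_tail2X_lt q i : (i < 2 * q)%N -> fcoef (exp_tail2 ^+ q) i = 0.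
Proof.
rewrite -(fps_divXK exp_tail2_lt) exprMn -exprM fcoef_mulXn => iq.
by rewrite leqNgt iq.
Qed.

(** Pairing half-edges: [x] marks half-edges, and [odd_fact N] is the number of
    ways to pair [2 N] of them into [N] edges. The number [N] is given as a
    difference, with the value 0 for a negative one. *)
Definition gauss_moment n q (f : fps rat) : rat :=
  if (n <= q)%N then odd_fact (q - n) * fcoef f (2 * (q - n)) else 0.

Lemma gauss_moment_sum n q (I : Type) (r : seq I) (P : pred I)
    (F : I -> fps rat) :
  gauss_moment n q (\sum_(i <- r | P i) F i) =
  \sum_(i <- r | P i) gauss_moment n q (F i).
Proof.
rewrite /gauss_moment; case: ifP => _; last by rewrite big1.
by rewrite fcoef_sum mulr_sumr.
Qed.

Lemma gauss_momentCM n q c f :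
  gauss_moment n q (fpsC c * f) = c * gauss_moment n q f.
Proof.
by rewrite /gauss_moment; case: ifP => _; rewrite ?mulr0 // fcoefCM mulrCA.
Qed.

(** The multigraphs of excess [K] whose vertices all have degree at least 2, with
    [q] vertices and hence [q + K] edges: the half-edges at each vertex are
    distributed by [exp x - 1 - x]. *)
Definition core_series K : fps rat := Fps (fun q =>
  odd_fact (q + K) / q`!%:R * fcoef (exp_tail2 ^+ q) (2 * (q + K))).

Lemma fcoef_core_series K q : fcoef (core_series K) q =
  odd_fact (q + K) / q`!%:R * fcoef (exp_tail2 ^+ q) (2 * (q + K)).
Proof. by []. Qed.

Lemma core_series_gauss n m t q :
  (if (n <= m + t)%N then fcoef (core_series (m + t - n)) q else 0) =
  (q`!%:R)^-1 * gauss_moment n (m + t + q) (exp_tail2 ^+ q).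
Proof.
case: leqP => nmt.
  rewrite /gauss_moment (leq_trans nmt (leq_addr _ _)) fcoef_core_series.
  rewrite (_ : q + (m + t - n) = m + t + q - n)%N; last by lia.
  by rewrite mulrAC mulrC.
rewrite /gauss_moment; case: ifP => nq; rewrite ?mulr0 //.
by rewrite fcoef_exp_tail2X_lt ?mulr0 //; lia.
Qed.

(** [T - T ^ 2 / 2], the series of unrooted trees in terms of that of rooted
    trees. *)
Definition unrooted_of_rooted : fps rat := fpsX * (1 + fpsC (- 2%:R^-1) * fpsX).

Lemma fcoef_mulX_unrooted q t s : fcoef (fpsX ^+ q * unrooted_of_rooted ^+ t) s =
  if (t + q <= s)%N then
    (- 2%:R^-1) ^+ (s - (t + q)) * 'C(t, s - (t + q))%:R else 0.
Proof.
rewrite /unrooted_of_rooted exprMn mulrA -exprD addnC fcoef_mulXn.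
by case: ifP => // _; rewrite fcoef_1DX.
Qed.

(** The weight of all multigraphs with [a] vertices and excess [m - n]; writing
    the excess as a difference covers the negative values, which tree components
    require. *)
Definition multigraph_weight n m a : rat := if (n <= m + a)%N then
   a%:R ^+ (2 * (m + a - n)) / (2%:R ^+ (m + a - n) * (m + a - n)`!%:R * a`!%:R)
   else 0.

Lemma gauss_moment_expX n q a b : gauss_moment n q (fpsX ^+ b * exp_series a%:R) =
  if (n <= q)%N && (b <= 2 * (q - n))%N then
    odd_fact (q - n) * (a%:R ^+ (2 * (q - n) - b) / (2 * (q - n) - b)`!%:R)
  else 0.
Proof.
rewrite /gauss_moment fcoef_mulXn; case: leqP => //= _.
by case: ifP; rewrite ?mulr0.
Qed.

(** The binomial theorem merges the [q] core vertices and the [p - q] trees: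
    [exp x - 1 - x] plus the 1 coming from [T - T ^ 2 / 2 = T (1 - T / 2)] is
    [exp x - x], and [s - p] counts the factors [- T / 2]. *)
Lemma sum_gauss_moment_tail n Q p s : (p <= s)%N ->
  \sum_(q < p.+1) (fcoef (fpsX ^+ q * unrooted_of_rooted ^+ (p - q)) s
    / ((p - q)`!%:R * q`!%:R) * gauss_moment n Q (exp_tail2 ^+ q)) =
  if (s <= 2 * p)%N then
    (- 2%:R^-1) ^+ (s - p) / ((s - p)`!%:R * (2 * p - s)`!%:R)
      * gauss_moment n Q ((fps_exp - fpsX) ^+ (2 * p - s))
  else 0.
Proof.
move=> ps; under eq_bigr => q _ do
  rewrite fcoef_mulX_unrooted (subnK (leq_ord q)) ps.
case: leqP => sp; last first.
  by rewrite big1 // => q _; rewrite bin_small ?mulr0 ?mul0r //; lia.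
set r := (2 * p - s)%N.
have -> : fps_exp - fpsX = 1 + exp_tail2 by rewrite /exp_tail2; ring.
pose F q := 'C(r, q)%:R * gauss_moment n Q (exp_tail2 ^+ q).
have -> : gauss_moment n Q ((1 + exp_tail2) ^+ r) = \sum_(q < p.+1) F q.
  rewrite (@eq_sum_ord _ F p.+1 r.+1) => [|q]; last first.
    by rewrite geq_min /F => qpr; rewrite bin_small ?mul0r //; lia.
  rewrite exprDn gauss_moment_sum; apply: eq_bigr => q _.
  by rewrite expr1n mul1r -mulr_natl -(rmorph_nat (@fpsC rat)) gauss_momentCM.
rewrite mulr_sumr; apply: eq_bigr => q _; rewrite /F !mulrA; congr (_ * _).
have qp : (q <= p)%N by rewrite -ltnS.
case: (leqP q r) => qr; last by rewrite !bin_small ?(mulr0, mul0r) //; lia.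
rewrite !bin_natr //; last by lia.
rewrite (_ : p - q - (s - p) = r - q)%N; last by lia.
have := fact_natr_neq0 (p - q); have := fact_natr_neq0 (s - p).
have := fact_natr_neq0 (r - q); have := fact_natr_neq0 q.
have := fact_natr_neq0 r => ? ? ? ? ?; field.
by do !(apply/andP; split).
Qed.

Lemma gauss_moment_expBX n Q r :
  gauss_moment n Q ((fps_exp - fpsX) ^+ r) =
  \sum_(a < r.+1) 'C(r, a)%:R * (-1) ^+ (r - a)
    * gauss_moment n Q (fpsX ^+ (r - a) * exp_series a%:R).
Proof.
rewrite addrC exprDn gauss_moment_sum; apply: eq_bigr => a _.
rewrite exp_seriesE exp_seriesX mulr1 [in LHS]exprNn.
rewrite -(rmorph_sign (@fpsC rat)) -mulrA.
rewrite -[X in gauss_moment n Q X = _]mulr_natl -(rmorph_nat (@fpsC rat)).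
by rewrite gauss_momentCM -mulrA gauss_momentCM.
Qed.

(** For each [a], the terms in [exp (a x)] add up to one term of the series of
    all multigraphs, by [odd_fact_bin_sum] with [K = m + s - n] and [c = s - a]:
    the power [a ^ (2 K - c)] does not depend on [p]. *)
Lemma sum_gauss_moment_expX n m a s :
  \sum_(p < s.+1) (if (s <= 2 * p)%N && (a <= 2 * p - s)%N then
     (- 2%:R^-1) ^+ (s - p) / ((s - p)`!%:R * (2 * p - s)`!%:R)
     * ('C(2 * p - s, a)%:R * (-1) ^+ (2 * p - s - a)
        * gauss_moment n (m + p) (fpsX ^+ (2 * p - s - a) * exp_series a%:R)) else 0) =
  multigraph_weight n m a * fcoef (tree_inv ^+ a) s.
Proof.
rewrite fcoef_tree_invX; case: (leqP a s) => sa; last first.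
  by rewrite mulr0 big1 // => p _; case: andP => // -[]; have := ltn_ord p; lia.
rewrite /multigraph_weight; case: (leqP n (m + s)) => nms; last first.
  rewrite leqNgt (leq_ltn_trans _ nms) ?leq_add2l //= mul0r big1 // => p _.
  case: ifP => // _; rewrite /gauss_moment leqNgt (leq_ltn_trans _ nms) ?mulr0 //.
  by rewrite leq_add2l -ltnS.
set K := (m + s - n)%N; set c := (s - a)%N.
(* The new index [l = s - p] is the number of factors [- T / 2]. *)
rewrite (reindex_inj rev_ord_inj) /=.
transitivity (if (c <= 2 * K)%N then
    (-1) ^+ c * a%:R ^+ (2 * K - c) / ((2 * K - c)`!%:R * a`!%:R) *
    \sum_(l < s.+1) (if (2 * l <= c)%N && (l <= K)%N then
     (- 2%:R^-1) ^+ l / (l`!%:R * (c - 2 * l)`!%:R) * odd_fact (K - l) else 0)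
  else 0).
  case: leqP => cK; last first.
    rewrite big1 // => l _; case: ifP => // /andP[l1 l2].
    rewrite gauss_moment_expX ifF ?mulr0 //; apply/negbTE/negP => /andP[l3 l4].
    by move: l1 l2 l3 l4 cK; rewrite /K /c; have := ltn_ord l; lia.
  rewrite mulr_sumr; apply: eq_bigr => l _.
  have ls : (l <= s)%N by rewrite -ltnS.
  rewrite !subSS subKn //.
  have -> : (s <= 2 * (s - l))%N && (a <= 2 * (s - l) - s)%N = (2 * l <= c)%N.
    by rewrite /c; lia.
  case: (leqP (2 * l) c) => lc /=; last by rewrite mulr0.
  rewrite gauss_moment_expX.
  rewrite (_ : 2 * (s - l) - s - a = c - 2 * l)%N; last by rewrite /c; lia.
  case: (leqP l K) => lK; last first.
    rewrite ifF ?mulr0 //; apply/negbTE/negP => /andP[l3 l4].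
    by move: l3 lK; rewrite /K; lia.
  rewrite ifT; last by move: cK lK lc; rewrite /K /c; lia.
  rewrite (_ : m + (s - l) - n = K - l)%N; last by rewrite /K; lia.
  rewrite (_ : 2 * (K - l) - (c - 2 * l) = 2 * K - c)%N; last by lia.
  rewrite bin_natr; last by move: lc; rewrite /c; lia.
  rewrite (_ : 2 * (s - l) - s - a = c - 2 * l)%N; last by rewrite /c; lia.
  have -> : (-1) ^+ (c - 2 * l) = (-1) ^+ c :> rat.
    by rewrite -[in RHS](subnK lc) exprD exprM sqrrN expr1n mulr1.
  have := fact_natr_neq0 (2 * (s - l) - s); have := fact_natr_neq0 l.
  have := fact_natr_neq0 (c - 2 * l); have := fact_natr_neq0 a.
  have := fact_natr_neq0 (2 * K - c) => ? ? ? ? ?; field.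
  by do !(apply/andP; split).
have -> : (n <= m + a)%N = (c <= K)%N by rewrite /c /K; lia.
case: (leqP c (2 * K)) => cK2; last first.
  by rewrite leqNgt (leq_ltn_trans _ cK2) ?mul0r //; lia.
rewrite odd_fact_bin_sum // ?leq_subr //.
case: leqP => cK; last by rewrite mulr0 mul0r.
rewrite (_ : m + a - n = K - c)%N; last by move: cK; rewrite /c /K; lia.
rewrite [(- a%:R) ^+ c]exprNn (_ : 2 * K - c = 2 * (K - c) + c)%N; last by lia.
rewrite exprD.
have := fact_natr_neq0 (2 * (K - c) + c); have := fact_natr_neq0 (K - c).
have := fact_natr_neq0 c; have := fact_natr_neq0 a.
have p2 : 2%:R ^+ (K - c) != 0 :> rat by rewrite expf_neq0.
move=> ? ? ? ?; field.
by do !(apply/andP; split).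
Qed.

(** With [z = T exp (- T)], the series of all multigraphs of excess [m - n] is
    obtained from cores by adding [t] tree components, each of which lowers the
    excess by 1. *)
Lemma multigraph_identity n m s N : (s <= N)%N ->
  \sum_(t < N.+1) (if (n <= m + t)%N then
     t`!%:R^-1 * fcoef (unrooted_of_rooted ^+ t * core_series (m + t - n)) s
   else 0) =
  \sum_(a < N.+1) multigraph_weight n m a * fcoef (tree_inv ^+ a) s.
Proof.
move=> sN.
pose G t q := fcoef (fpsX ^+ q * unrooted_of_rooted ^+ t) s
    / (t`!%:R * q`!%:R) * gauss_moment n (m + t + q) (exp_tail2 ^+ q).
transitivity (\sum_(t < N.+1) \sum_(q < N.+1) G t q).
  apply: eq_bigr => t _.
  transitivity (t`!%:R^-1 * \sum_(q < s.+1)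
    (if (n <= m + t)%N then fcoef (core_series (m + t - n)) q else 0)
     * fcoef (unrooted_of_rooted ^+ t) (s - q)).
    case: ifP => _.
      by rewrite mulrC [unrooted_of_rooted ^+ t * _]mulrC mulrC fcoefM.
    by rewrite big1 ?mulr0 // => q _; rewrite mul0r.
  rewrite (big_ord_widen N.+1 (fun q => (if (n <= m + t)%N
    then fcoef (core_series (m + t - n)) q else 0)
     * fcoef (unrooted_of_rooted ^+ t) (s - q))) // big_mkcond mulr_sumr.
  apply: eq_bigr => q _; rewrite core_series_gauss /G fcoef_mulXn ltnS.
  case: ifP => _; last by rewrite mulr0 !mul0r.
  by rewrite invfM; ring.
rewrite (sum_triangle sN) => [|t q stq]; last first.
  by rewrite /G fcoef_mulX_unrooted leqNgt stq !mul0r.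
transitivity (\sum_(p < s.+1) \sum_(a < N.+1)
  (if (s <= 2 * p)%N && (a <= 2 * p - s)%N then
     (- 2%:R^-1) ^+ (s - p) / ((s - p)`!%:R * (2 * p - s)`!%:R)
     * ('C(2 * p - s, a)%:R * (-1) ^+ (2 * p - s - a)
        * gauss_moment n (m + p) (fpsX ^+ (2 * p - s - a) * exp_series a%:R)) else 0)).
  apply: eq_bigr => p _; have ps : (p <= s)%N by rewrite -ltnS.
  transitivity (\sum_(q < p.+1) (fcoef (fpsX ^+ q * unrooted_of_rooted ^+ (p - q)) s
      / ((p - q)`!%:R * q`!%:R) * gauss_moment n (m + p) (exp_tail2 ^+ q))).
    by apply: eq_bigr => q _; rewrite /G -addnA subnK // -ltnS.
  rewrite sum_gauss_moment_tail //; case: leqP => sp; last by rewrite big1.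
  rewrite gauss_moment_expBX mulr_sumr (big_ord_widen N.+1 (fun a =>
     (- 2%:R^-1) ^+ (s - p) / ((s - p)`!%:R * (2 * p - s)`!%:R)
     * ('C(2 * p - s, a)%:R * (-1) ^+ (2 * p - s - a)
        * gauss_moment n (m + p) (fpsX ^+ (2 * p - s - a) * exp_series a%:R)))).
    by rewrite big_mkcond; apply: eq_bigr => a _; rewrite ltnS.
  by rewrite ltnS; lia.
rewrite exchange_big; apply: eq_bigr => a _; exact: sum_gauss_moment_expX.
Qed.

(** * Positive multigraphs in closed form *)

Lemma odd_factS K : odd_fact K.+1 = (2 * K + 1)%:R * odd_fact K.
Proof.
rewrite /odd_fact mulnS !factS !natrM !natrX exprS.
have := fact_natr_neq0 K; have p2 : 2%:R ^+ K != 0 :> rat by rewrite expf_neq0.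
have K1 : K.+1%:R != 0 :> rat by rewrite pnatr_eq0.
have -> : (2 * K).+2%:R = 2%:R * K.+1%:R :> rat by rewrite -natrM; congr _%:R; lia.
move: K1; rewrite addn1; move: (K.+1%:R : rat) => x x0 f0; field.
by rewrite x0 f0 p2.
Qed.

Lemma odd_fact0 : odd_fact 0 = 1.
Proof. by rewrite /odd_fact !muln0 fact0 expn0 divr1. Qed.

Lemma odd_fact_gbinom K j :
  odd_fact K * ((-1) ^+ j * gbinom (- K%:R - 2%:R^-1) j) * 2%:R ^+ j =
  odd_fact (j + K) / j`!%:R.
Proof.
elim: j => [|j IHj]; first by rewrite gbinom0 add0n fact0 divr1 !expr0 !mulr1.
have j1 : j.+1%:R != 0 :> rat by rewrite pnatr_eq0.
rewrite -[gbinom _ j.+1](mulfK j1) gbinomS addSn odd_factS factS natrM.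
transitivity ((odd_fact K * ((-1) ^+ j * gbinom (- K%:R - 2%:R^-1) j) * 2%:R ^+ j)
   * ((2 * (j + K) + 1)%:R / j.+1%:R)); last first.
  by rewrite IHj; field; rewrite fact_natr_neq0 nat1r j1.
rewrite !exprS natrD natrM natrD; field.
by rewrite nat1r j1.
Qed.

(** Clearing the powers of [x ^ 2 / 2] that normalise the exponential
    remainders. *)
Lemma odd_fact_gbinom_coef K j (r h : fps rat) :
    fpsX ^+ 2 * r = 2%:R * h ->
  odd_fact K * ((-1) ^+ j * gbinom (- K%:R - 2%:R^-1) j * fcoef (r ^+ j) (2 * K))
  = odd_fact (j + K) / j`!%:R * fcoef (h ^+ j) (2 * (j + K)).
Proof.
move=> rh; rewrite -odd_fact_gbinom.
have -> : fcoef (r ^+ j) (2 * K) = 2%:R ^+ j * fcoef (h ^+ j) (2 * (j + K)).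
  transitivity (fcoef (fpsX ^+ (2 * j) * r ^+ j) (2 * (j + K))).
    by rewrite fcoef_mulXn leq_mul2l leq_addr orbT -mulnBr addKn.
  by rewrite exprM -exprMn rh exprMn -(rmorph_nat (@fpsC rat)) -rmorphXn fcoefCM.
by ring.
Qed.

Lemma exp_rem2E : fpsX ^+ 2 * exp_rem2 = 2%:R * exp_tail2.
Proof. by rewrite mulrCA fps_divXK //; apply: exp_tail2_lt. Qed.

Lemma exp_rem2_0 : fcoef exp_rem2 0 = 1.
Proof. by rewrite fcoefZn. Qed.

(** The multigraphs of excess [K] without tree components: a rooted tree hangs
    from each vertex of a core. *)
Definition treeless K : fps rat := fps_comp idfun (core_series K) Tree.

Lemma treeless_pow K : treeless K = fpsC (odd_fact K) * xcoef (2 * K)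
  (fps_pow (1 - lift_z Tree * lift_x exp_rem2) (- K%:R - 2%:R^-1)).
Proof.
apply: fpsP => n; rewrite fcoefCM fcoef_xcoef_pow ?Tree0 // mulr_sumr fcoef_comp.
apply: eq_bigr => j _; rewrite fcoef_core_series -(odd_fact_gbinom_coef K j exp_rem2E).
exact: esym (mulrA _ _ _).
Qed.

(** The inverse of the series of multigraphs all of whose components have
    excess 0. *)
Definition sqrt_1BTree : fps rat := fps_pow (1 - Tree) 2%:R^-1.

Lemma fcoef0_1BTree : fcoef (1 - Tree) 0 = 1.
Proof. by rewrite fcoefD fcoefN Tree0 fcoef1 subr0. Qed.

Lemma xcoef0_pow h r a : fcoef h 0 = 0 -> fcoef r 0 = 1 ->
  xcoef 0 (fps_pow (1 - lift_z h * lift_x r) a) = fps_pow (1 - h) a.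
Proof.
move=> h0 r0; apply: fpsP => n; rewrite fcoef_xcoef_pow //=.
apply: eq_bigr => j _; rewrite ratr_id_rat addrAC subrr sub0r.
rewrite fcoef0X r0 expr1n mulr1 [in RHS]exprNn.
by rewrite -(rmorph_sign (@fpsC rat)) fcoefCM -mulrA mulrCA.
Qed.

(** The constant term in [x] of [1 - T exp_rem2] is [1 - T]. *)
Lemma sqrt_treeless0 : sqrt_1BTree * treeless 0 = 1.
Proof.
rewrite treeless_pow odd_fact0 rmorph1 mul1r muln0 xcoef0_pow ?exp_rem2_0 //.
rewrite (_ : - 0%:R - _ = - 2%:R^-1) ?mulr0n ?oppr0 ?sub0r //.
exact: (fps_powN ratr_id_rat) fcoef0_1BTree.
Qed.

Lemma fcoef0_sqrt : fcoef sqrt_1BTree 0 = 1.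
Proof. exact: (fcoef0_pow ratr_id_rat). Qed.

Lemma fcoef0_treeless K : fcoef (treeless K) 0 = (K == 0%N)%:R.
Proof.
rewrite fcoef_comp big_ord1 expr0 mulr1 fcoef_core_series expr0 fcoef1 add0n muln_eq0.
by case: K => [|K]; rewrite ?mulr0 // odd_fact0 divr1.
Qed.

Definition unrooted_tree : fps rat := fps_comp idfun unrooted_of_rooted Tree.

Lemma unrooted_tree0 : fcoef unrooted_tree 0 = 0.
Proof. by rewrite fcoef_comp big_ord1 fcoef_mulX0 mul0r. Qed.

(** [multigraph_identity] with [T] replaced by the tree series, which turns
    [T exp (- T)] into the variable. *)
Lemma sum_unrooted_treeless n m :
  \sum_(t < n.+1) (if (n <= m + t)%N then
     t`!%:R^-1 * fcoef (unrooted_tree ^+ t * treeless (m + t - n)) n else 0) =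
  multigraph_weight n m n.
Proof.
transitivity (\sum_(s < n.+1) (\sum_(t < n.+1) (if (n <= m + t)%N then
     t`!%:R^-1 * fcoef (unrooted_of_rooted ^+ t * core_series (m + t - n)) s
     else 0)) * fcoef (Tree ^+ s) n).
  under [RHS]eq_bigr do rewrite mulr_suml.
  rewrite exchange_big; apply: eq_bigr => t _.
  case: ifP => _; last by rewrite big1 // => s _; rewrite mul0r.
  rewrite /unrooted_tree /treeless -fps_compXn ?Tree0 // -fps_compM ?Tree0 //.
  rewrite fcoef_comp mulr_sumr.
  by apply: eq_bigr => s _; rewrite mulrA.
transitivity (\sum_(s < n.+1) (\sum_(a < n.+1)
    multigraph_weight n m a * fcoef (tree_inv ^+ a) s) * fcoef (Tree ^+ s) n).
  by apply: eq_bigr => s _; rewrite multigraph_identity // -ltnS.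
under eq_bigr do rewrite mulr_suml.
rewrite exchange_big big_ord_recr /= big1 ?add0r => [|a _].
  under eq_bigr do rewrite -mulrA.
  rewrite -mulr_sumr -[X in _ * X]/(fcoef (fps_comp idfun (tree_inv ^+ n) Tree) n).
  by rewrite fps_compXn ?Tree0 // tree_inv_Tree fcoef_fpsXn eqxx mulr1.
under eq_bigr do rewrite -mulrA.
rewrite -mulr_sumr -[X in _ * X]/(fcoef (fps_comp idfun (tree_inv ^+ a) Tree) n).
by rewrite fps_compXn ?Tree0 // tree_inv_Tree fcoef_fpsXn gtn_eqF ?mulr0.
Qed.

(** Both pairs of arrays below factor the weights of all multigraphs: the first
    pair is combinatorial, the second one explicit. *)
Definition pos_weight i j : rat :=
  (count_pos i j)%:R / (i`!%:R * (2 ^ j * j`!)%N%:R).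
Definition nonpos_weight i j : rat :=
  (count_nonpos i j)%:R / (i`!%:R * (2 ^ j * j`!)%N%:R).
Definition pos_closed i j : rat :=
  if (i <= j)%N then fcoef (sqrt_1BTree * treeless (j - i)) i else 0.
Definition nonpos_closed i j : rat :=
  if (j <= i)%N then
    (i - j)`!%:R^-1 * fcoef (treeless 0 * unrooted_tree ^+ (i - j)) i
  else 0.

Lemma conv_multigraph_weight n m :
  \sum_(i < n.+1) \sum_(j < m.+1) pos_weight i j * nonpos_weight (n - i) (m - j)
  = multigraph_weight n m n.
Proof.
rewrite /multigraph_weight leq_addl addnK -natrX multigraph_split natr_sum mulr_suml.
apply: eq_bigr => i _; rewrite natr_sum mulr_suml; apply: eq_bigr => j _.
have ni := leq_ord i; have mj := leq_ord j.
rewrite /pos_weight /nonpos_weight !natrM !bin_natr // !natrX.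
rewrite -[in 2%:R ^+ m](subnK mj) exprD.
have := fact_natr_neq0 n; have := fact_natr_neq0 m.
have := fact_natr_neq0 i; have := fact_natr_neq0 j.
have := fact_natr_neq0 (n - i); have := fact_natr_neq0 (m - j).
have p2 l : 2%:R ^+ l != 0 :> rat by rewrite expf_neq0.
move: (p2 (m - j)%N) (p2 j) => ? ? ? ? ? ? ? ?; field.
by do !(apply/andP; split).
Qed.

(** The product of the two closed forms is
    [unrooted_tree ^ t / t! * treeless (m + t - n)], because [treeless 0] cancels
    the square root; [t] is the number of trees, the excess of the nonpositive
    part being [- t]. *)
Lemma conv_closed n m :
  \sum_(i < n.+1) \sum_(j < m.+1) pos_closed i j * nonpos_closed (n - i) (m - j)
  = multigraph_weight n m n.
Proof.
rewrite -sum_unrooted_treeless.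
transitivity (\sum_(i < n.+1) \sum_(t < n.+1) if (n <= m + t)%N then
   fcoef (sqrt_1BTree * treeless (m + t - n)) i *
   (t`!%:R^-1 * fcoef (treeless 0 * unrooted_tree ^+ t) (n - i)) else 0).
  (* With [i] vertices in the positive part, the [d] others carry [d - t]
     edges. *)
  apply: eq_bigr => i _; have ni := leq_ord i; set d := (n - i)%N.
  rewrite (reindex_inj rev_ord_inj) /=.
  pose F j := if (j <= m)%N then pos_closed i (m - j) * nonpos_closed d j else 0.
  transitivity (\sum_(j < m.+1) F j).
    by apply: eq_bigr => j _; rewrite /F subSS leq_ord subKn ?leq_ord.
  rewrite (@eq_sum_ord _ F m.+1 d.+1) => [|j]; last first.
    rewrite geq_min /F => jmd; case: leqP => // jm.
    by rewrite /nonpos_closed leqNgt ifF ?mulr0 //; lia.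
  rewrite (reindex_inj rev_ord_inj) /=.
  rewrite (@eq_sum_ord _ (fun t => if (n <= m + t)%N then
     fcoef (sqrt_1BTree * treeless (m + t - n)) i *
     (t`!%:R^-1 * fcoef (treeless 0 * unrooted_tree ^+ t) d) else 0)
     n.+1 d.+1) => [|t]; last first.
    rewrite geq_min => tnd; case: ifP => // _.
    rewrite -(fps_divXK (d := t) (f := unrooted_tree ^+ t)) => [|l lt]; last first.
      by rewrite fcoef_exp_lt ?unrooted_tree0.
    rewrite [treeless 0 * _]mulrCA fcoef_mulXn leqNgt ifF ?mulr0 //; lia.
  apply: eq_bigr => t _; have td := leq_ord t; rewrite /F subSS.
  rewrite /pos_closed /nonpos_closed leq_subr subKn //.
  case: (leqP n (m + t)) => nmt.
    rewrite ifT; last by move: td nmt ni; rewrite /d; lia.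
    rewrite ifT; last by move: td nmt ni; rewrite /d; lia.
    rewrite (_ : m - (d - t) - i = m + t - n)%N //.
    by move: td nmt ni; rewrite /d; lia.
  case: ifP => // dm; rewrite ifF ?mul0r //; apply/negbTE; rewrite -ltnNge.
  by move: dm td nmt ni; rewrite /d; lia.
rewrite exchange_big; apply: eq_bigr => t _; case: ifP => _; last by rewrite big1.
transitivity (t`!%:R^-1 * fcoef ((sqrt_1BTree * treeless (m + t - n))
  * (treeless 0 * unrooted_tree ^+ t)) n).
  by rewrite fcoefM mulr_sumr; apply: eq_bigr => i _; rewrite mulrCA.
congr (_ * fcoef _ _).
transitivity ((sqrt_1BTree * treeless 0)
  * (unrooted_tree ^+ t * treeless (m + t - n))).
  by ring.
by rewrite sqrt_treeless0 mul1r.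
Qed.

(** The combinatorial and the explicit arrays have the same convolution and the
    same supports, hence agree. *)
Lemma MGpos_closed k : MGpos k = sqrt_1BTree * treeless k.
Proof.
apply: fpsP => n; transitivity (pos_weight n (n + k)).
  rewrite /pos_weight -[LHS]/(\sum_(G : multigraph n (n + k) | positive G)
    ((2 ^ (n + k) * (n + k)`!)%N%:R^-1 / n`!%:R)).
  by rewrite sumr_const -[LHS]mulr_natl [in RHS]invfM [X in _ = _ * X]mulrC.
transitivity (pos_closed n (n + k)); last first.
  by rewrite /pos_closed leq_addr addKn.
apply: (factorisation_uniq (f := nonpos_weight) (f' := nonpos_closed)).
- by move=> i j ij; rewrite /nonpos_weight count_nonpos_eq0 // mul0r.
- by move=> i j ij; rewrite /nonpos_closed leqNgt ij.
- by rewrite /nonpos_weight count_no_vertices.2 !fact0.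
- by rewrite /nonpos_closed leqnn expr0 mulr1 fcoef0_treeless fact0.
- move=> i j ij; rewrite /pos_weight.
  case: (posnP (i + j)) => [/eqP|ij0].
    rewrite addn_eq0 => /andP[/eqP -> /eqP ->].
    by rewrite count_no_vertices.1 !fact0.
  by rewrite count_pos_eq0 // mul0r; case: i j ij0 {ij} => [|i] [|j].
- move=> i j; rewrite /pos_closed; case: (ltngtP i j) => [ij|ij|<-].
  + rewrite orFb => /eqP ->.
    by rewrite fcoef0M fcoef0_sqrt fcoef0_treeless mul1r subn0.
  + by move=> _; case: i ij.
  + by rewrite subnn sqrt_treeless0 fcoef1 andbb.
- by move=> i j; rewrite conv_multigraph_weight conv_closed.
Qed.

(** * The kernel polynomial *)

Definition exp_tail3 : fps rat := fps_exp - 1 - fpsX - fpsX ^+ 2 / 2%:R.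

Lemma fps_half : (2%:R : fps rat)^-1 = fpsC 2%:R^-1.
Proof. by rewrite fmorphV rmorph_nat. Qed.

Lemma fcoef_exp_tail3 n :
  fcoef exp_tail3 n = if (n < 3)%N then 0 else n`!%:R^-1.
Proof.
rewrite /exp_tail3 fps_half mulrC !fcoefD !fcoefN fcoefCM fcoef_fpsXn fcoef1.
by case: n => [|[|[|n]]] //=; rewrite ?mulr0 ?subr0.
Qed.

Lemma exp_rem3E : fpsX ^+ 2 * exp_rem3 = 2%:R * exp_tail3.
Proof.
rewrite mulrCA fps_divXK // => i i2; rewrite fcoef_exp_tail3.
by rewrite (leq_trans i2).
Qed.

Lemma exp_rem3_0 : fcoef exp_rem3 0 = 0.
Proof. by rewrite fcoefZn [fcoef (fps_divX _ _) _]fcoef_exp_tail3 mulr0. Qed.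

Lemma exp_rem2_rem3 : exp_rem2 = 1 + exp_rem3.
Proof.
apply: fpsP => n; rewrite fcoefD !fcoefZn fcoef1.
rewrite -[fcoef (fps_divX _ _) n]/(fcoef exp_tail2 (n + 2)).
rewrite -[fcoef (fps_divX _ _) n]/(fcoef exp_tail3 (n + 2)).
rewrite -[exp_tail2](subrK (fpsX ^+ 2 / 2%:R)) fcoefD mulrDr addrC; congr (_ + _).
rewrite fps_half [fpsX ^+ 2 * _]mulrC fcoefCM fcoef_fpsXn mulrA mulfV // mul1r.
by rewrite addn2 !eqSS.
Qed.

Definition kernel_coef k j : rat :=
  (-1) ^+ j * gbinom (- k%:R - 2%:R^-1) j * fcoef (exp_rem3 ^+ j) (2 * k).

Definition kernel_poly k : {poly rat} :=
  odd_fact k *: \sum_(j < (2 * k).+1) kernel_coef k j *: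
    ('X^j * (1 - 'X) ^+ (2 * k - j)).

(** Evaluated at the variable this is [MK_series], evaluated at [Tree] it is the
    numerator of the generating function; the sum is finite because [exp_rem3]
    has no constant term. *)
Lemma kernel_poly_eval k (y : fps rat) : fcoef y 0 = 0 ->
  (map_poly (@fpsC rat) (kernel_poly k)).[y] =
  fpsC (odd_fact k) * (1 - y) ^+ (2 * k) *
  xcoef (2 * k) (fps_pow (1 - lift_z (y / (1 - y)) * lift_x exp_rem3)
                         (- k%:R - 2%:R^-1)).
Proof.
move=> y0; have u1y : 1 - y \is a GRing.unit.
  by apply: fps_unit1; rewrite fcoefD fcoefN y0 fcoef1 subr0.
rewrite xcoef_pow_fin ?exp_rem3_0 //; last by rewrite fcoef0M y0 mul0r.
rewrite map_polyZ hornerZ -mulrA; congr (_ * _).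
rewrite rmorph_sum horner_sum mulr_sumr; apply: eq_bigr => j _.
rewrite /= map_polyZ hornerZ mulrCA; congr (_ * _).
rewrite rmorphM !rmorphXn rmorphB rmorph1 /= map_polyX.
rewrite hornerM !horner_exp hornerD hornerN hornerX hornerC.
rewrite exprMn exprVn mulrCA; congr (_ * _).
have -> : (1 - y) ^+ (2 * k) = (1 - y) ^+ (2 * k - j) * (1 - y) ^+ j.
  by rewrite -exprD subnK ?leq_ord.
by rewrite mulrK // unitrX.
Qed.

Lemma fps_of_polyE (p : {poly rat}) :
  fps_of_poly p = (map_poly (@fpsC rat) p).[fpsX].
Proof.
apply: fpsP => n; rewrite -(@fps_comp_poly _ _ idfun (fps_of_poly p)) //.
by rewrite fps_comp_fpsX.
Qed.

(** Factoring [1 - T] out of the base of the power separates the sizes of the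
    trees and paths from the kernel. *)
Lemma sqrt_treeless_kernel k : sqrt_1BTree * treeless k =
  eval_at_Tree (kernel_poly k) / (1 - Tree) ^+ (3 * k).
Proof.
have uT : 1 - Tree \is a GRing.unit := fps_unit1 fcoef0_1BTree.
rewrite /eval_at_Tree kernel_poly_eval ?Tree0 // treeless_pow.
set a := - k%:R - 2%:R^-1.
set D := 1 - lift_z (Tree / (1 - Tree)) * lift_x exp_rem3.
have -> : 1 - lift_z Tree * lift_x exp_rem2 = lift_z (1 - Tree) * D.
  rewrite /D mulrBr mulr1 mulrA -rmorphM mulrCA divrr // mulr1.
  have -> : lift_x exp_rem2 = 1 + lift_x exp_rem3.
    by rewrite exp_rem2_rem3 /lift_x rmorphD rmorph1.
  by rewrite rmorphB rmorph1; ring.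
rewrite (fps_powM ratr_fpsC); last 2 first.
- by rewrite fcoef_lift_z fcoef0_1BTree rmorph1.
- rewrite fcoefD fcoefN fcoef0M fcoef_lift_z fcoef0M Tree0 mul0r rmorph0 mul0r.
  by rewrite subr0 fcoef1.
rewrite -lift_z_pow xcoef_lift_zM; set X := xcoef _ _.
have -> : (1 - Tree) ^+ (3 * k) = (1 - Tree) ^+ (2 * k) * (1 - Tree) ^+ k.
  by rewrite -exprD; congr (_ ^+ _); lia.
have Sk : sqrt_1BTree * fps_pow (1 - Tree) a * (1 - Tree) ^+ k = 1.
  rewrite /sqrt_1BTree -(fps_pow_nat ratr_id_rat k fcoef0_1BTree).
  rewrite -!(fps_powD ratr_id_rat) ?fcoef0_1BTree //.
  have -> : 2%:R^-1 + a + k%:R = 0%:R by rewrite /a; ring.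
  by rewrite (fps_pow_nat ratr_id_rat) ?fcoef0_1BTree.
apply: (mulIr (unitrX k uT)); apply: (mulIr (unitrX (2 * k) uT)).
rewrite -[RHS]mulrA -[_ ^+ k * _]mulrC divrK ?unitrM ?unitrX //.
transitivity (fpsC (odd_fact k) * (1 - Tree) ^+ (2 * k) * X *
  (sqrt_1BTree * fps_pow (1 - Tree) a * (1 - Tree) ^+ k)); first by ring.
by rewrite Sk mulr1.
Qed.

Lemma sqrt_treeless_B k : sqrt_1BTree * treeless k =
  fpsC (odd_fact k) * xcoef (2 * k)
  (lift_z (fps_pow (1 - Tree) 2%:R^-1) * fps_pow B (k%:R + 2%:R^-1)).
Proof.
rewrite xcoef_lift_zM /B (fps_powV ratr_fpsC); last first.
  by rewrite fcoefD fcoefN fcoef0M fcoef_lift_z Tree0 rmorph0 mul0r subr0 fcoef1.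
by rewrite opprD treeless_pow mulrCA.
Qed.

(** * Degree of the kernel polynomial *)

(** [N! / j! [x ^ N] (exp x - 1 - x - x ^ 2 / 2) ^ j] counts the partitions of a
    set of [N] elements into [j] blocks of size at least 3. *)
Definition stirling3 N j : rat := N`!%:R / j`!%:R * fcoef (exp_tail3 ^+ j) N.

Lemma fps_deriv_exp_tail3 :
  fps_deriv exp_tail3 = exp_tail3 + fpsC 2%:R^-1 * fpsX ^+ 2.
Proof.
have factV n : n.+1`!%:R^-1 *+ n.+1 = n`!%:R^-1 :> rat.
  rewrite -[LHS]mulr_natr factS natrM invfM mulrAC mulVf ?mul1r //.
  by rewrite pnatr_eq0.
apply: fpsP => n; rewrite fcoef_deriv [RHS]fcoefD fcoefCM fcoef_fpsXn.
rewrite !fcoef_exp_tail3.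
case: n => [|[|[|n]]]; rewrite ?mul0rn ?mulr0 ?addr0 ?add0r ?factV ?mulr1 //.
Qed.

(** The last element lies either in a block of size at least 4, which remains
    admissible without it, or in a block of size 3. *)
Lemma stirling3_rec N j : stirling3 N.+3 j.+1 =
  j.+1%:R * stirling3 N.+2 j.+1 + 'C(N.+2, 2)%:R * stirling3 N j.
Proof.
have := congr1 (fun f => fcoef f N.+2) (fps_derivX exp_tail3 j).
rewrite fcoef_deriv fcoefMn fps_deriv_exp_tail3 mulrDr -exprSr mulrCA fcoefD.
rewrite fcoefCM [_ * fpsX ^+ 2]mulrC fcoef_mulXn subn2 /= => rec.
rewrite /stirling3 bin_natr // subn2 [N.+3`!]factS natrM.
set x := fcoef _ N.+3 in rec *; set y := fcoef _ N.+2 in rec *.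
set z := fcoef _ N in rec *.
have -> : N.+3%:R * N.+2`!%:R / j.+1`!%:R * x = N.+2`!%:R / j.+1`!%:R * (x *+ N.+3).
  by rewrite -mulr_natr; ring.
rewrite rec -[(_ + _) *+ _]mulr_natr [j.+1`!]factS natrM.
have j1 : j.+1%:R != 0 :> rat by rewrite pnatr_eq0.
move: (fact_natr_neq0 j) (fact_natr_neq0 N) j1.
move: (j.+1%:R : rat) (j`!%:R : rat) (N`!%:R : rat) (N.+2`!%:R : rat).
by move=> j1 j0 N0 N2 j0n N0n j1n; rewrite [2`!%:R]/(2%:R : rat); field;
  rewrite j0n N0n j1n.
Qed.

Lemma fcoef_exp_tail3X_lt j N : (N < 3 * j)%N -> fcoef (exp_tail3 ^+ j) N = 0.
Proof.
rewrite -(@fps_divXK _ 3 exp_tail3) => [|i i3]; last by rewrite fcoef_exp_tail3 i3.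
by rewrite exprMn -exprM fcoef_mulXn => Nj; rewrite leqNgt Nj.
Qed.

Lemma stirling3_lt N j : (N < 3 * j)%N -> stirling3 N j = 0.
Proof. by move=> Nj; rewrite /stirling3 fcoef_exp_tail3X_lt ?mulr0. Qed.

Lemma stirling3_int N j : stirling3 N j \is a Num.int.
Proof.
elim: j N => [|j IHj] N.
  by rewrite /stirling3 expr0 fcoef1 fact0 divr1 rpredM ?rpred_nat.
elim: N => [|N IHN]; first by rewrite stirling3_lt ?rpred0 // mulnS.
case: N IHN => [|[|N]] IHN; try by rewrite stirling3_lt ?rpred0 // mulnS.
by rewrite stirling3_rec; apply: rpredD; apply: rpredM; rewrite ?rpred_nat.
Qed.

Lemma stirling3_diag j :
  stirling3 (3 * j) j = (\prod_(i < j) 'C(3 * i + 2, 2))%N%:R.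
Proof.
elim: j => [|j IHj].
  by rewrite muln0 big_ord0 /stirling3 expr0 fcoef1 !fact0 divr1 mulr1.
rewrite big_ord_recr natrM -IHj [RHS]mulrC /= addn2.
have -> : (3 * j.+1 = (3 * j).+3)%N by rewrite mulnS.
by rewrite stirling3_rec stirling3_lt ?mulr0 ?add0r // mulnS.
Qed.

(** Each factor is [(3 i + 2) (3 i + 1) / 2], which is prime to 3. *)
Lemma stirling3_diag_ndvd j : ~~ (3 %| \prod_(i < j) 'C(3 * i + 2, 2))%N.
Proof.
elim: j => [|j IHj]; first by rewrite big_ord0.
rewrite big_ord_recr /= Euclid_dvdM // negb_or IHj /=.
apply/negP => /(dvdn_mull 2).
rewrite -mul_bin_diag bin1 Euclid_dvdM // addn2 /=; lia.
Qed.

Lemma kernel_poly_lead k : (kernel_poly k)`_(2 * k) =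
  \sum_(j < (2 * k).+1) (-1) ^+ j *
    (stirling3 (2 * (j + k)) j / (2%:R ^+ (j + k) * (j + k)`!%:R)).
Proof.
rewrite coefZ coef_sum mulr_sumr; apply: eq_bigr => j _.
have j2k := leq_ord j.
rewrite coefZ mulrA [_ * kernel_coef _ _](odd_fact_gbinom_coef k j exp_rem3E).
have -> : ('X^j * (1 - 'X) ^+ (2 * k - j) : {poly rat})`_(2 * k) = (-1) ^+ j.
  rewrite coefXnM ltnNge j2k /= -[1 - 'X]opprB [in LHS]exprNn.
  rewrite -(rmorph_sign (@polyC rat)) coefCM -[1 : {poly rat}]/(1%:P).
  have := monic_exp (2 * k - j) (monicXsubC (1 : rat)).
  move=> /monicP; rewrite lead_coefE size_exp_XsubC /= => ->.
  rewrite mulr1 -[in RHS]signr_odd -signr_odd; congr (_ ^+ _).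
  by rewrite oddB // oddM.
rewrite mulrC; congr (_ * _); rewrite /stirling3 /odd_fact natrM natrX.
have p2 : 2%:R ^+ (j + k) != 0 :> rat by rewrite expf_neq0.
have := fact_natr_neq0 j; have := fact_natr_neq0 (j + k) => ? ?; field.
by do !(apply/andP; split).
Qed.

(** All terms but the last have denominators dividing [2 ^ (3 k) (3 k - 1)!],
    whereas the last one is [stirling3 (6 k) (2 k) / (2 ^ (3 k) (3 k)!)] with a
    numerator prime to 3: there is no cancellation 3-adically. *)
Lemma kernel_poly_lead_neq0 k : (kernel_poly k)`_(2 * k) != 0.
Proof.
rewrite kernel_poly_lead; case: (posnP k) => [->|k0].
  rewrite muln0 big_ord1 /stirling3 !expr0 fcoef1 !fact0.
  by rewrite !mul1r ?oner_eq0.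
(* This factor clears all denominators except a factor [3 k] in the last term. *)
apply/eqP; rewrite big_ord_recr /= => /(congr1 (GRing.mul
  (2%:R ^+ (3 * k) * (3 * k).-1`!%:R))); rewrite mulr0 mulrDr.
rewrite (_ : 2 * k + k = 3 * k)%N; last by lia.
rewrite (_ : 2 * (3 * k) = 3 * (2 * k))%N; last by lia.
rewrite stirling3_diag [(-1) ^+ _]exprM sqrrN !expr1n mul1r.
set s := (\prod_(i < 2 * k) _)%N; set t := _ * \sum_(j < _) _.
have tint : t \is a Num.int.
  rewrite /t mulr_sumr rpred_sum // => j _; have j2k := ltn_ord j.
  have -> : 2%:R ^+ (3 * k) = 2%:R ^+ (3 * k - (j + k)) * 2%:R ^+ (j + k) :> rat.
    by rewrite -exprD subnK //; move: j2k; lia.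
  have jk : (j + k <= (3 * k).-1)%N by move: j2k k0; lia.
  rewrite -(bin_fact jk) !natrM.
  set b := 'C(_, _)%:R; set f := ((3 * k).-1 - (j + k))`!%:R.
  set p := _ ^+ (3 * k - (j + k)).
  have -> : p * 2%:R ^+ (j + k) * (b * ((j + k)`!%:R * f)) *
      ((-1) ^+ j * (stirling3 (2 * (j + k)) j / (2%:R ^+ (j + k) * (j + k)`!%:R)))
      = (-1) ^+ j * (p * b * f * stirling3 (2 * (j + k)) j).
    have p2 : 2%:R ^+ (j + k) != 0 :> rat by rewrite expf_neq0.
    have := fact_natr_neq0 (j + k) => ?; field.
    by apply/andP.
  suff int_pbfs : p * b * f * stirling3 (2 * (j + k)) j \is a Num.int.
    by rewrite rpredMsign.
  apply: rpredM (stirling3_int _ _); apply: rpredM (rpred_nat _ _).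
  apply: rpredM (rpred_nat _ _); exact: rpredX (rpred_nat _ _).
have -> : 2%:R ^+ (3 * k) * (3 * k).-1`!%:R *
    (s%:R / (2%:R ^+ (3 * k) * (3 * k)`!%:R)) = s%:R / (3 * k)%:R :> rat.
  have k30 : (0 < 3 * k)%N by rewrite muln_gt0.
  rewrite -[in (3 * k)`!](prednK k30) factS natrM prednK //.
  have p2 : 2%:R ^+ (3 * k) != 0 :> rat by rewrite expf_neq0.
  have x0 : (3 * k)%:R != 0 :> rat by rewrite pnatr_eq0 -lt0n.
  have := fact_natr_neq0 (3 * k).-1.
  move: ((3 * k)%:R : rat) x0 ((3 * k).-1`!%:R : rat) => x x0 f f0; field.
  by rewrite p2 f0 x0.
move/eqP; rewrite addrC addr_eq0 => /eqP st.
have /intrP[z zE] : s%:R / (3 * k)%:R \is a @Num.int rat by rewrite st rpredN.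
have k3 : (3 * k)%:R != 0 :> rat by rewrite pnatr_eq0 muln_eq0 -lt0n.
have : (s%:Z = z * (3 * k)%:Z)%R.
  apply: (@intr_inj rat); rewrite intrM -zE -!pmulrn divfK //.
move/(congr1 absz); rewrite abszM !absz_nat => sE.
by move: (stirling3_diag_ndvd (2 * k)); rewrite -/s sE mulnCA dvdn_mulr.
Qed.

Lemma size_kernel_poly k : size (kernel_poly k) = (2 * k).+1.
Proof.
apply/eqP; rewrite eqn_leq; apply/andP; split; last first.
  rewrite ltnNge; apply: contra (kernel_poly_lead_neq0 k) => sz.
  by rewrite nth_default.
rewrite (leq_trans (size_scale_leq _ _)) // (leq_trans (size_sum _ _ _)) //.
apply/bigmax_leqP => j _; rewrite (leq_trans (size_scale_leq _ _)) //.
rewrite mulrC size_mulXn; last first.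
  by rewrite expf_neq0 // -opprB oppr_eq0 polyXsubC_eq0.
rewrite -[1 - 'X]opprB exprNn -signr_odd mulr_sign.
by case: (odd _); rewrite ?size_polyN size_exp_XsubC addnS subnKC // leq_ord.
Qed.

Theorem proposition3 (k : nat) :
  exists MK : {poly rat},
    [/\ size MK = (2 * k).+1,
        fps_of_poly MK = MK_series k,
        MGpos k = eval_at_Tree MK / (1 - Tree) ^+ (3 * k)
      & MGpos k =
          fpsC (odd_fact k) *
          xcoef (2 * k)
            (lift_z (fps_pow (1 - Tree) 2%:R^-1) *
             fps_pow B (k%:R + 2%:R^-1))].
Proof.
exists (kernel_poly k); split.
- exact: size_kernel_poly.
- by rewrite fps_of_polyE kernel_poly_eval.
- by rewrite MGpos_closed sqrt_treeless_kernel.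
- by rewrite MGpos_closed sqrt_treeless_B.
Qed.
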